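(* Let $d\geq2$. Every Zariski-dense subgroup $\Gamma\le\mathrm{PSL}(d,\mathbb{R})$ satisfies property $\mathrm{P}_{\mathrm{PHP}}$.
   Context: A (discrete) group $\Gamma$ has property $\mathrm{P}_{\mathrm{PHP}}$ if for every finite subset $F\subset\Gamma$ and every $\varepsilon>0$ there is $N\in\mathbb{N}$ such that for every $n\geq N$ there are elements $t_i\in\Gamma$ and subsets $C_i\subset D_i\subset\Gamma$, $1\le i\le n$, such that the members of the family $\{aC_i : a\in F,\ i=1,\ldots,n\}\cup\{bt_j^{-1}(\Gamma\setminus D_j): b\in F,\ j=1,\ldots,n\}$ are mutually disjoint (as a family indexed by the pairs $(a,i)$ and $(b,j)$) and $$\sup_{x\in\Gamma}\bigl|\{i: x\in D_i\}\cup\{j: x\in t_j^{-1}(\Gamma\setminus C_j)\}\bigr|\le\varepsilon n^{1/2}.$$ The subgroup $\Gamma$ is regarded as an abstract (discrete) group. *)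

(* Defs.v *)
From HB Require Import structures.
From mathcomp Require Import all_boot all_order all_algebra.
From mathcomp Require Import all_classical all_reals.
(* The notations of multinomials clash with those of mathcomp-classical;
   [mpoly n R] is the type usually written {mpoly R[n]}. *)
From mathcomp Require Import -(notations) mpoly.

Set Implicit Arguments.
Unset Strict Implicit.
Unset Printing Implicit Defensive.

Import Order.TTheory GRing.Theory Num.Theory.

Local Open Scope classical_set_scope.
Local Open Scope ring_scope.

Definition subgroup (G : groupType) (S : groupClosed G) : Type :=
  {x : G | x \in S}.

Section SubgroupGroup.
Variables (G : groupType) (S : groupClosed G).

HB.instance Definition _ := [isSub of subgroup S for @sval _ _].
HB.instance Definition _ := [Choice of subgroup S by <:].

Let subgroup_closed : group_closed (fun x : G => x \in S).
Proof. by split=> [|x y xS yS]; [exact: gpred1|exact: gpredF]. Qed.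

HB.instance Definition _ :=
  SubChoice_isSubGroup.Build G (fun x : G => x \in S) (subgroup S)
    subgroup_closed.
End SubgroupGroup.

Definition SL (R : fieldType) (d : nat) : Type := {A : 'M[R]_d | \det A == 1}.

Section SLGroup.
Variables (R : fieldType) (d : nat).

HB.instance Definition _ := [isSub of SL R d for @sval _ _].
HB.instance Definition _ := [Choice of SL R d by <:].

Implicit Types A B : SL R d.

Let detSL A : \det (val A) = 1. Proof. exact/eqP/(valP A). Qed.

Let unitSL A : val A \in unitmx. Proof. by rewrite unitmxE detSL unitr1. Qed.

Fact SL_one_proof : \det (1%:M : 'M[R]_d) == 1.
Proof. by rewrite det1. Qed.
Definition SL_one : SL R d := Sub 1%:M SL_one_proof.

Fact SL_mul_proof A B : \det (val A *m val B) == 1.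
Proof. by rewrite det_mulmx !detSL mulr1. Qed.
Definition SL_mul A B : SL R d := Sub (val A *m val B) (SL_mul_proof A B).

Fact SL_inv_proof A : \det (invmx (val A)) == 1.
Proof. by rewrite det_inv detSL invr1. Qed.
Definition SL_inv A : SL R d := Sub (invmx (val A)) (SL_inv_proof A).

Fact SL_mulA : associative SL_mul.
Proof. by move=> A B C; apply: val_inj; rewrite /= mulmxA. Qed.
Fact SL_mul1 : left_id SL_one SL_mul.
Proof. by move=> A; apply: val_inj; rewrite /= mul1mx. Qed.
Fact SL_mulr1 : right_id SL_one SL_mul.
Proof. by move=> A; apply: val_inj; rewrite /= mulmx1. Qed.
Fact SL_mulV : left_inverse SL_one SL_inv SL_mul.
Proof. by move=> A; apply: val_inj; rewrite /= mulVmx ?unitSL. Qed.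
Fact SL_mulrV : right_inverse SL_one SL_inv SL_mul.
Proof. by move=> A; apply: val_inj; rewrite /= mulmxV ?unitSL. Qed.

HB.instance Definition _ :=
  isGroup.Build (SL R d) SL_mulA SL_mul1 SL_mulr1 SL_mulV SL_mulrV.

Lemma SL_valM A B : val (A * B)%g = val A *m val B. Proof. by []. Qed.
Lemma SL_valV A : val A^-1%g = invmx (val A). Proof. by []. Qed.
Lemma SL_val1 : val (1%g : SL R d) = 1%:M. Proof. by []. Qed.

(* The scalar matrices of determinant 1 form the center of SL(d, R). *)
Definition scalarSL A : bool := is_scalar_mx (val A).

Lemma scalarSL1 : scalarSL 1%g.
Proof. by rewrite /scalarSL SL_val1 scalar_mx_is_scalar. Qed.

Lemma scalarSLM A B : scalarSL A -> scalarSL B -> scalarSL (A * B)%g.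
Proof.
rewrite /scalarSL SL_valM => /is_scalar_mxP[a ->] /is_scalar_mxP[b ->].
by rewrite -scalar_mxM scalar_mx_is_scalar.
Qed.

Lemma scalarSLV A : scalarSL A -> scalarSL A^-1%g.
Proof.
rewrite /scalarSL SL_valV => /is_scalar_mxP[a ->].
by rewrite invmx_scalar scalar_mx_is_scalar.
Qed.

Lemma scalarSL_comm A B : scalarSL A -> (A * B)%g = (B * A)%g.
Proof.
move=> /is_scalar_mxP[a Aa]; apply: val_inj.
by rewrite !SL_valM Aa scalar_mxC.
Qed.

Definition PSL_rel A B : bool := scalarSL (A^-1 * B)%g.

Fact PSL_rel_refl : reflexive PSL_rel.
Proof. by move=> A; rewrite /PSL_rel mulVg scalarSL1. Qed.

Fact PSL_rel_sym : ssrbool.symmetric PSL_rel.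
Proof.
by move=> A B; apply/idP/idP => /scalarSLV; rewrite invgM invgK.
Qed.

Fact PSL_rel_trans : transitive PSL_rel.
Proof.
by move=> B A C /scalarSLM AB /AB; rewrite mulgA mulgK.
Qed.

Definition PSL_equiv := EquivRel PSL_rel PSL_rel_refl PSL_rel_sym PSL_rel_trans.

End SLGroup.

Local Open Scope quotient_scope.

Definition PSL (R : fieldType) (d : nat) : Type := {eq_quot (PSL_equiv R d)}.

Section PSLGroup.
Variables (R : fieldType) (d : nat).

HB.instance Definition _ := Choice.on (PSL R d).
HB.instance Definition _ := EqQuotient.on (PSL R d).

Definition toPSL (A : SL R d) : PSL R d := \pi_(PSL R d) A.

Lemma toPSL_eq (A B : SL R d) :
  (toPSL A == toPSL B) = is_scalar_mx (val (A^-1 * B)%g).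
Proof. by rewrite eqmodE. Qed.

Lemma toPSL_repr (x : PSL R d) : toPSL (repr x) = x.
Proof. exact: reprK. Qed.

Let toPSLP (A B : SL R d) : reflect (toPSL A = toPSL B) (scalarSL (A^-1 * B)%g).
Proof. by rewrite -[scalarSL _]toPSL_eq; exact: eqP. Qed.

Definition PSL_one : PSL R d := toPSL 1%g.
Definition PSL_mul (x y : PSL R d) : PSL R d := toPSL (repr x * repr y)%g.
Definition PSL_inv (x : PSL R d) : PSL R d := toPSL (repr x)^-1%g.

Let scalar_repr (A : SL R d) : scalarSL (A^-1 * repr (toPSL A))%g.
Proof. by apply/toPSLP; rewrite toPSL_repr. Qed.

Lemma PSL_mulE (A B : SL R d) : PSL_mul (toPSL A) (toPSL B) = toPSL (A * B)%g.
Proof.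
apply/esym/toPSLP; set A' := repr _; set B' := repr _.
have -> : ((A * B)^-1 * (A' * B') = (A^-1 * A') * (B^-1 * B'))%g.
  rewrite invgM -mulgA (mulgA A^-1%g) mulgA -(scalarSL_comm _ (scalar_repr A)).
  by rewrite -!mulgA.
exact: scalarSLM (scalar_repr A) (scalar_repr B).
Qed.

Lemma PSL_invE (A : SL R d) : PSL_inv (toPSL A) = toPSL A^-1%g.
Proof.
apply/toPSLP; rewrite invgK; set A' := repr _.
have sA : scalarSL (A^-1 * A')%g by exact: scalar_repr.
have -> : (A' * A^-1 = A^-1 * A')%g.
  by rewrite -[A' in LHS](mulVKg A) -(scalarSL_comm A sA) mulgK.
exact: sA.
Qed.

Fact PSL_mulA : associative PSL_mul.
Proof.
move=> x y z; rewrite -(toPSL_repr x) -(toPSL_repr y) -(toPSL_repr z).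
by rewrite !PSL_mulE mulgA.
Qed.
Fact PSL_mul1 : left_id PSL_one PSL_mul.
Proof. by move=> x; rewrite -(toPSL_repr x) PSL_mulE mul1g. Qed.
Fact PSL_mulr1 : right_id PSL_one PSL_mul.
Proof. by move=> x; rewrite -(toPSL_repr x) PSL_mulE mulg1. Qed.
Fact PSL_mulV : left_inverse PSL_one PSL_inv PSL_mul.
Proof. by move=> x; rewrite -(toPSL_repr x) PSL_invE PSL_mulE mulVg. Qed.
Fact PSL_mulrV : right_inverse PSL_one PSL_inv PSL_mul.
Proof. by move=> x; rewrite -(toPSL_repr x) PSL_invE PSL_mulE mulgV. Qed.

HB.instance Definition _ :=
  isGroup.Build (PSL R d) PSL_mulA PSL_mul1 PSL_mulr1 PSL_mulV PSL_mulrV.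

Lemma toPSLM (A B : SL R d) : toPSL (A * B)%g = (toPSL A * toPSL B)%g.
Proof. exact/esym/PSL_mulE. Qed.

End PSLGroup.

Section Zariski.
Variables (R : fieldType) (d : nat).

(* A polynomial in the d * d matrix entries, evaluated at A. *)
Definition mxeval (p : mpoly (d * d) R) (A : 'M[R]_d) : R :=
  meval (fun k => mxvec A 0 k) p.

Definition SL_zariski_closed (Z : set (SL R d)) : Prop :=
  exists S : set (mpoly (d * d) R),
    Z = [set A | forall p, S p -> mxeval p (val A) = 0].

(* PSL(d, R) carries the quotient topology of SL(d, R). *)
Definition PSL_zariski_closed (Z : set (PSL R d)) : Prop :=
  SL_zariski_closed (@toPSL R d @^-1` Z).

Definition zariski_dense (X : set (PSL R d)) : Prop :=
  forall Z : set (PSL R d), PSL_zariski_closed Z -> X `<=` Z -> Z = setT.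

End Zariski.

Section PHP.
Variable G : groupType.

Definition ltrans (a : G) (A : set G) : set G := [set (a * x)%g | x in A].

Section Family.
Variables (n : nat) (F : set G) (t : 'I_n -> G) (C D : 'I_n -> set G).

(* The index inl (a, i) stands for a C_i, and inr (b, j) for
   b t_j^-1 (G \ D_j); the two kinds of indices are never identified. *)
Definition PHP_index : set (G * 'I_n + G * 'I_n) :=
  [set u | match u with inl p => F p.1 | inr p => F p.1 end].

Definition PHP_family (u : G * 'I_n + G * 'I_n) : set G :=
  match u with
  | inl (a, i) => ltrans a (C i)
  | inr (b, j) => ltrans (b * (t j)^-1)%g (~` D j)
  end.

Definition PHP_cover (x : G) : {set 'I_n} :=
  ([set i | x \in D i] :|: [set j | x \in ltrans (t j)^-1%g (~` C j)])%SET.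

End Family.

(* The supremum is that of a nonempty set of reals bounded by n. *)
Definition PHP (R : realType) : Prop :=
  forall F : set G, finite_set F -> forall eps : R, 0 < eps ->
  exists N : nat, forall n : nat, (N <= n)%N ->
  exists (t : 'I_n -> G) (C D : 'I_n -> set G),
    [/\ forall i, C i `<=` D i,
        trivIset (PHP_index F) (PHP_family t C D) &
        sup [set (#|PHP_cover t C D x|)%:R | x in [set: G]]
          <= eps * Num.sqrt (n%:R : R)].

End PHP.

(* Main.v *)
(* A sequence s_m in Gamma such that s_m and s_m^-1 converge projectively to
   rank one matrices p phi and p psi plays ping-pong: up to scaling, s_m maps
   the complement of a neighbourhood of the hyperplane ker phi into a
   neighbourhood of the point p, and s_m^-1 does the same with ker psi. Taking
   t_j = g_j s_m h_j^-1 with generic g_j, h_j in Gamma, the points b g_j p and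
   b h_j p (b in F) are distinct, while the hyperplanes ker (psi g_j^-1) and
   ker (phi h_j^-1) are in general position, so that a point lies in fewer than
   d of their neighbourhoods. Hence the multiplicity is bounded independently
   of n.

   Rank one limits exist because, in a projective limit of minimal rank r, the
   compressions of Gamma generate a bounded group up to scaling and so preserve
   a definite quadratic form up to scaling; by Zariski density all r x r
   matrices do, which forces r = 1. *)

Require Import Defs.
From HB Require Import structures.
From mathcomp Require Import all_boot all_order all_algebra.
From mathcomp Require Import all_classical all_reals.
From mathcomp Require Import topology normedtype ring lra.
From mathcomp Require Import -(notations) mpoly.

Set Implicit Arguments.
Unset Strict Implicit.
Unset Printing Implicit Defensive.

Import Order.TTheory GRing.Theory Num.Theory.
Import numFieldNormedType.Exports.

Local Open Scope classical_set_scope.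
Local Open Scope ring_scope.

(** * Entrywise norm and compactness *)

Section MatrixNorm.
Variable R : realType.

(** The sets live in [Gam] itself: an orbit map [vec] sends group elements to vectors, and
    neighbourhoods are pulled back along it. With [E_j] the neighbourhood of the hyperplane of
    [phi h_j^-1], the choice [C_j = t_j (Gam \ E_j)] makes [t_j^-1 (Gam \ C_j)] equal to [E_j], so
    the covering count sees only hyperplane neighbourhoods. The delicate point is the inclusion of
    [C_j] in [D_j], the neighbourhood of the hyperplane of [psi g_j^-1]: as [C_j] gathers near
    [g_j p], it needs [psi p = 0], which holds for [d > 1]. The constants are fixed in the order
    [dl] for hyperplanes, [eta] for points, and only then the element [s], after all the [g_j] and
    [h_j]. *)

Definition mxN m n (A : 'M[R]_(m, n)) : R := \sum_i \sum_j `|A i j|.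

Lemma mxN_ge0 m n (A : 'M[R]_(m, n)) : 0 <= mxN A.
Proof. by do 2!apply: sumr_ge0 => ? _. Qed.
Hint Resolve mxN_ge0 : core.

Lemma ler_mxN m n (A : 'M[R]_(m, n)) i j : `|A i j| <= mxN A.
Proof.
rewrite /mxN (bigD1 i) //= (bigD1 j) //= -addrA lerDl addr_ge0 //.
  exact: sumr_ge0.
by do 2!apply: sumr_ge0 => ? _.
Qed.

Lemma mxN0 m n : mxN (0 : 'M[R]_(m, n)) = 0.
Proof. by rewrite /mxN big1 // => i _; rewrite big1 // => j _; rewrite mxE normr0. Qed.

Lemma mxN_eq0 m n (A : 'M[R]_(m, n)) : (mxN A == 0) = (A == 0).
Proof.
apply/eqP/eqP => [A0|->]; last exact: mxN0.
by apply/matrixP => i j; rewrite mxE; apply/eqP; rewrite -normr_le0 -A0 ler_mxN.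
Qed.

Lemma mxN_gt0 m n (A : 'M[R]_(m, n)) : (0 < mxN A) = (A != 0).
Proof. by rewrite lt_def mxN_ge0 mxN_eq0 andbT. Qed.

Lemma mxND m n (A B : 'M[R]_(m, n)) : mxN (A + B) <= mxN A + mxN B.
Proof.
rewrite /mxN -big_split; apply: ler_sum => i _; rewrite -big_split.
by apply: ler_sum => j _; rewrite mxE ler_normD.
Qed.

Lemma mxNZ m n c (A : 'M[R]_(m, n)) : mxN (c *: A) = `|c| * mxN A.
Proof.
rewrite /mxN mulr_sumr; apply: eq_bigr => i _; rewrite mulr_sumr.
by apply: eq_bigr => j _; rewrite mxE normrM.
Qed.

Lemma mxNN m n (A : 'M[R]_(m, n)) : mxN (- A) = mxN A.
Proof. by rewrite -scaleN1r mxNZ normrN1 mul1r. Qed.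

Lemma mxN_distC m n (A B : 'M[R]_(m, n)) : mxN (A - B) = mxN (B - A).
Proof. by rewrite -opprB mxNN. Qed.

Lemma mxN_triang m n (A B : 'M[R]_(m, n)) : mxN A <= mxN B + mxN (A - B).
Proof. by rewrite -{1}(subrK B A) addrC mxND. Qed.

Lemma mxNM m n p (A : 'M[R]_(m, n)) (B : 'M[R]_(n, p)) :
  mxN (A *m B) <= mxN A * mxN B.
Proof.
rewrite {2}/mxN mulr_suml; apply: ler_sum => i _.
rewrite mulr_suml; under eq_bigr do rewrite mxE.
apply: (@le_trans _ _ (\sum_j \sum_k `|A i k| * `|B k j|)).
  apply: ler_sum => j _; apply: le_trans (ler_norm_sum _ _ _) _.
  by apply: ler_sum => k _; rewrite normrM.
rewrite exchange_big; apply: ler_sum => k _ /=.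
rewrite -mulr_sumr ler_wpM2l //.
by rewrite /mxN (bigD1 k) //= lerDl; do 2!apply: sumr_ge0 => ? _.
Qed.

Lemma mxN_scalar (A : 'M[R]_1) : mxN A = `|A 0 0|.
Proof. by rewrite /mxN !big_ord1. Qed.

(* Bolzano-Weierstrass, for a decreasing family of sets of bounded matrices. *)
Lemma mx_cluster m n (C : R) (P : R -> 'M[R]_(m, n) -> Prop) :
  (forall e e' A, 0 < e -> e <= e' -> P e A -> P e' A) ->
  (forall e, 0 < e -> exists2 A, P e A & mxN A <= C) ->
  exists L, forall e, 0 < e -> exists2 A, P e A & mxN (A - L) < e.
Proof.
move=> Pmono Pex.
pose K := [set v : 'rV[R]_(m * n) | forall k, `[-C, C]%classic (v 0 k)].
have Kc : compact K.
  by apply: (@rV_compact R _ (fun=> `[-C, C]%classic)) => _; exact: segment_compact.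
pose S e := [set v : 'rV[R]_(m * n) | P e (vec_mx v) /\ mxN (vec_mx v : 'M_(m, n)) <= C].
pose F := filter_from [set e : R | 0 < e] S.
have FF : ProperFilter F.
  apply: filter_from_proper; last first.
    move=> e /= /Pex[A PA NA]; exists (mxvec A).
    by split; rewrite mxvecK.
  apply: filter_from_filter; first by exists 1 => /=.
  move=> a b /= a0 b0; exists (Num.min a b) => /=; first by rewrite lt_min a0 b0.
  move=> v [Pv Nv]; split; split=> //; apply: Pmono Pv;
    by rewrite ?lt_min ?a0 ?b0 // ge_min lexx ?orbT.
have FK : F K.
  exists 1 => //= v [_ Nv] k; rewrite /= in_itv /= -ler_norml.
  case/mxvec_indexP: k => i j.
  by have := ler_mxN (vec_mx v) i j; rewrite mxE => /le_trans; exact.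
have [L [_ clL]] := Kc F FF FK.
exists (vec_mx L) => e e0.
pose e1 := e / ((m * n)%:R + 1).
have mn0 : 0 < (m * n)%:R + 1 :> R by rewrite ltr_wpDl.
have e10 : 0 < e1 by rewrite divr_gt0.
have FSe : F (S e) by exists e.
have [|v [[Pv _] Bv]] := clL (S e) (ball L e1) FSe; first exact: nbhsx_ballx.
exists (vec_mx v) => //.
have vL k : `|v 0 k - L 0 k| <= e1.
  by case: Bv => _ /(_ 0 k); rewrite distrC => /ltW.
rewrite -linearB /=.
apply: (@le_lt_trans _ _ (\sum_(i < m) \sum_(j < n) e1)).
  by apply: ler_sum => i _; apply: ler_sum => j _; rewrite !mxE; exact: vL.
rewrite !sumr_const !card_ord -mulrnA mulnC -mulr_natr /e1 -mulrA.
rewrite gtr_pMr // mulrC ltr_pdivrMr // mul1r.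
by rewrite ltrDl.
Qed.

End MatrixNorm.
#[global] Hint Extern 0 (is_true (0 <= mxN _)) => exact: mxN_ge0 : core.

Lemma common_eps (R : realType) (T : finType) (P : T -> R -> Prop) :
  (forall i e e', 0 < e' -> e' <= e -> P i e -> P i e') ->
  (forall i, exists2 e, 0 < e & P i e) -> exists2 e, 0 < e & forall i, P i e.
Proof.
move=> Pm Pex.
have [f f0 Pf] : exists2 f : T -> R, forall i, 0 < f i & forall i, P i (f i).
  have /choice[f fP] : forall i, exists e, 0 < e /\ P i e.
    by move=> i; have [e ? ?] := Pex i; exists e.
  by exists f => i; have [] := fP i.
suff [e e0 Pe] : exists2 e, 0 < e & forall i, i \in enum T -> e <= f i.
  by exists e => // i; apply: (Pm _ (f i)) => //; apply: Pe; rewrite mem_enum.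
elim: (enum T) => [|i s [e e0 se]]; first by exists 1.
exists (Num.min e (f i)); first by rewrite lt_min e0 f0.
move=> j; rewrite inE => /predU1P[->|js]; rewrite ge_min ?lexx ?orbT //.
by rewrite se.
Qed.

(** * Polynomial functions and generic matrices *)

Section PolynomialFunctions.
Variables (R : realType) (n : nat).
Implicit Types (f g : 'M[R]_n -> R) (A B : 'M[R]_n).

(** Inductive generation gives continuity, boundedness and restriction to lines by induction, and
    handles determinants and matrix products without monomials. The passage to [mpoly] happens once,
    in [polyf_mpoly], to meet the definition of Zariski closed sets. *)
Inductive polyf : ('M[R]_n -> R) -> Prop :=
| polyf_const c : polyf (fun=> c)
| polyf_coord i j : polyf (fun A => A i j)
| polyfD f g of polyf f & polyf g : polyf (fun A => f A + g A)
| polyfM f g of polyf f & polyf g : polyf (fun A => f A * g A).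

Lemma eq_polyf f g : f =1 g -> polyf f -> polyf g.
Proof. by move=> /funext ->. Qed.

Lemma polyfN f : polyf f -> polyf (fun A => - f A).
Proof.
move=> pf; apply: eq_polyf (polyfM (polyf_const (-1)) pf) => A.
by rewrite mulN1r.
Qed.

Lemma polyf_sum (I : Type) (r : seq I) (P : pred I) (F : I -> 'M[R]_n -> R) :
  (forall i, polyf (F i)) -> polyf (fun A => \sum_(i <- r | P i) F i A).
Proof.
move=> pF; elim: r => [|i r IH].
  by apply: eq_polyf (polyf_const 0) => A; rewrite big_nil.
have [Pi|nPi] := boolP (P i).
  by apply: eq_polyf (polyfD (pF i) IH) => A; rewrite big_cons Pi.
by apply: eq_polyf IH => A; rewrite big_cons (negPf nPi).
Qed.

Lemma polyf_prod (I : Type) (r : seq I) (P : pred I) (F : I -> 'M[R]_n -> R) :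
  (forall i, polyf (F i)) -> polyf (fun A => \prod_(i <- r | P i) F i A).
Proof.
move=> pF; elim: r => [|i r IH].
  by apply: eq_polyf (polyf_const 1) => A; rewrite big_nil.
have [Pi|nPi] := boolP (P i).
  by apply: eq_polyf (polyfM (pF i) IH) => A; rewrite big_cons Pi.
by apply: eq_polyf IH => A; rewrite big_cons (negPf nPi).
Qed.

Definition polyf_mx p q (F : 'M[R]_n -> 'M[R]_(p, q)) :=
  forall i j, polyf (fun A => F A i j).

Lemma polyf_mx_id : polyf_mx id.
Proof. exact: polyf_coord. Qed.

Lemma polyf_mx_const p q (B : 'M[R]_(p, q)) : polyf_mx (fun=> B).
Proof. by move=> i j; exact: polyf_const. Qed.

Lemma polyf_mxM p q s (F : 'M[R]_n -> 'M[R]_(p, q)) (G : 'M[R]_n -> 'M[R]_(q, s)) :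
  polyf_mx F -> polyf_mx G -> polyf_mx (fun A => F A *m G A).
Proof.
move=> pF pG i j.
apply: (@eq_polyf (fun A => \sum_k F A i k * G A k j)) => [A|]; first by rewrite mxE.
by apply: polyf_sum => k; exact: polyfM.
Qed.

Lemma polyf_mxT p q (F : 'M[R]_n -> 'M[R]_(p, q)) :
  polyf_mx F -> polyf_mx (fun A => (F A)^T).
Proof. by move=> pF i j; apply: eq_polyf (pF j i) => A; rewrite mxE. Qed.

Lemma polyf_mx_lin p q (B : 'M[R]_(p, n)) (C : 'M[R]_(n, q)) :
  polyf_mx (fun A => B *m A *m C).
Proof.
apply: polyf_mxM; last exact: polyf_mx_const.
by apply: polyf_mxM; [exact: polyf_mx_const|exact: polyf_mx_id].
Qed.

Lemma polyf_det p (F : 'M[R]_n -> 'M[R]_p) :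
  polyf_mx F -> polyf (fun A => \det (F A)).
Proof.
move=> pF; apply: polyf_sum => s.
by apply: polyfM; [exact: polyf_const|apply: polyf_prod => i].
Qed.

Lemma polyf_adj : polyf_mx (fun A => \adj A).
Proof.
move=> i j; apply: (@eq_polyf (fun A => cofactor A j i)) => [A|]; first by rewrite mxE.
apply: polyfM; first exact: polyf_const.
apply: polyf_det => k l.
by apply: eq_polyf (polyf_coord (lift j k) (lift i l)) => A; rewrite !mxE.
Qed.

Lemma polyf_line f A B : polyf f ->
  exists q : {poly R}, forall t, f (A + t *: B) = q.[t].
Proof.
elim=> [c|i j|{}f g _ [p fp] _ [q gq]|{}f g _ [p fp] _ [q gq]].
- by exists c%:P => t; rewrite hornerC.
- exists ((A i j)%:P + (B i j) *: 'X) => t.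
  by rewrite !mxE !hornerE mulrC.
- by exists (p + q) => t; rewrite hornerD fp gq.
- by exists (p * q) => t; rewrite hornerM fp gq.
Qed.

Lemma polyf_cont f L e : polyf f -> 0 < e ->
  exists2 dl, 0 < dl & forall A, mxN (A - L) < dl -> `|f A - f L| < e.
Proof.
move=> pf; elim: pf e => [c|i j|{}f g _ cf _ cg|{}f g _ cf _ cg] e e0.
- by exists 1 => // A _; rewrite subrr normr0.
- exists e => // A; apply: le_lt_trans.
  by have := ler_mxN (A - L) i j; rewrite !mxE.
- have [a a0 fa] := cf (e / 2) ltac:(by rewrite divr_gt0).
  have [b b0 gb] := cg (e / 2) ltac:(by rewrite divr_gt0).
  exists (Num.min a b) => [|A]; first by rewrite lt_min a0 b0.
  rewrite lt_min => /andP[/fa fA /gb gA].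
  rewrite opprD addrACA; apply: le_lt_trans (ler_normD _ _) _; lra.
- have M0 : 0 < `|f L| + `|g L| + 1 by rewrite ltr_wpDl// addr_ge0.
  pose M := `|f L| + `|g L| + 1.
  pose e1 := Num.min 1 (e / (2 * M)).
  have e10 : 0 < e1 by rewrite lt_min ltr01 divr_gt0// mulr_gt0.
  have [a a0 fa] := cf e1 e10; have [b b0 gb] := cg e1 e10.
  exists (Num.min a b) => [|A]; first by rewrite lt_min a0 b0.
  rewrite lt_min => /andP[/fa fA /gb gA].
  have -> : f A * g A - f L * g L = (f A - f L) * (g A - g L) +
     ((f A - f L) * g L + f L * (g A - g L)) by ring.
  apply: le_lt_trans (ler_normD _ _) _.
  apply: (@le_lt_trans _ _ (e1 * M)); last first.
    apply: (@le_lt_trans _ _ (e / 2)); last by lra.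
    by rewrite -ler_pdivlMr// ge_min -mulrA -invfM lexx orbT.
  have e11 : e1 <= 1 by rewrite ge_min lexx.
  have := ler_normD ((f A - f L) * g L) (f L * (g A - g L)).
  rewrite !normrM.
  have h1 : `|f A - f L| * `|g A - g L| <= e1 * 1.
    by apply: ler_pM => //; apply: ltW => //; exact: lt_le_trans gA e11.
  have h2 : `|f A - f L| * `|g L| <= e1 * `|g L| by rewrite ler_wpM2r// ltW.
  have h3 : `|f L| * `|g A - g L| <= `|f L| * e1 by rewrite ler_wpM2l// ltW.
  rewrite /M; lra.
Qed.

Lemma polyf_le_cluster (P : R -> 'M[R]_n -> Prop) L f mu : polyf f ->
  (forall e e' A, 0 < e -> e <= e' -> P e A -> P e' A) ->
  (forall e, 0 < e -> exists2 A, P e A & mxN (A - L) < e) ->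
  (forall e A, 0 < e -> P e A -> f A <= mu + e) -> f L <= mu.
Proof.
move=> pf Pm PL Pf; apply/ler_addgt0Pr => e e0.
have e20 : 0 < e / 2 by rewrite divr_gt0.
have [dl dl0 fdl] := polyf_cont L pf e20.
have [|A PA NA] := PL (Num.min dl (e / 2)); first by rewrite lt_min dl0 e20.
have {}PA : P (e / 2) A.
  by apply: Pm PA; rewrite ?lt_min ?dl0 ?e20// ge_min lexx orbT.
have := Pf _ _ e20 PA.
have {}NA : mxN (A - L) < dl by apply: lt_le_trans NA _; rewrite ge_min lexx.
have := fdl A NA.
rewrite ltr_norml => /andP[]; lra.
Qed.

Lemma polyf_mpoly f : polyf f ->
  exists p : mpoly (n * n) R, forall A, f A = mxeval p A.
Proof.
elim=> [c|i j|{}f g _ [p fp] _ [q gq]|{}f g _ [p fp] _ [q gq]].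
- by exists (mpolyC _ c) => A; rewrite /mxeval mevalC.
- by exists (mpolyX R (mnm1 (mxvec_index i j))) => A; rewrite /mxeval mevalXU mxvecE.
- by exists (p + q) => A; rewrite /mxeval mevalD fp gq.
- by exists (p * q) => A; rewrite /mxeval mevalM fp gq.
Qed.

Lemma small_nonroot (q : {poly R}) dl : q != 0 -> 0 < dl ->
  exists2 t, 0 < t < dl & q.[t] != 0.
Proof.
move=> q0 dl0; apply: contrapT => /forall2NP h.
pose rs := [seq dl / i.+2%:R | i <- iota 0 (size q)].
have ra : all (root q) rs.
  apply/allP => x /mapP[i _ ->]; apply/rootP/eqP.
  have [/negP|/negP/negPn//] := h (dl / i.+2%:R).
  by rewrite divr_gt0//= ltr_pdivrMr// ltr_pMr// ltr1n.
have ru : uniq rs.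
  rewrite map_inj_uniq ?iota_uniq// => i j /(mulfI (lt0r_neq0 dl0))/invr_inj.
  by move/eqP; rewrite eqr_nat => /eqP[].
by have := max_poly_roots q0 ra ru; rewrite size_map size_iota ltnn.
Qed.

Definition homog k f := forall c A, f (c *: A) = c ^+ k * f A.

(* Homogeneity makes the zero set in SL stable under scalars, so that it is the
   preimage of a Zariski closed subset of PSL. *)
Definition generic (P : 'M[R]_n -> Prop) := exists f k,
  [/\ polyf f, homog k f, exists A, f A != 0 &
      forall A, \det A = 1 -> f A != 0 -> P A].

Lemma generic_sub (P Q : 'M[R]_n -> Prop) :
  (forall A, \det A = 1 -> P A -> Q A) -> generic P -> generic Q.
Proof.
by move=> PQ [f [k [pf hf f0 fP]]]; exists f, k; split=> // A dA /fP; auto.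
Qed.

Lemma generic_true (P : 'M[R]_n -> Prop) : (forall A, P A) -> generic P.
Proof.
move=> PA; exists (fun=> 1), 0%N; split=> //; first exact: polyf_const.
  by move=> c A; rewrite expr0 mul1r.
by exists 0; rewrite oner_neq0.
Qed.

(** This is the irreducibility of the space of matrices: on the line through a nonzero of [f] and a
    nonzero of [g], both restrict to nonzero univariate polynomials, whose product has a nonroot. *)
Lemma generic_and (P Q : 'M[R]_n -> Prop) :
  generic P -> generic Q -> generic (fun A => P A /\ Q A).
Proof.
move=> [f [k [pf hf [A f0] fP]]] [g [l [pg hg [B g0] gQ]]].
exists (fun A => f A * g A), (k + l)%N; split; first exact: polyfM.
- by move=> c C; rewrite hf hg exprD; ring.
- have [p fp] := polyf_line A (B - A) pf.
  have [q gq] := polyf_line A (B - A) pg.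
  have pq0 : p * q != 0.
    rewrite mulf_neq0//.
      by apply: contraNneq f0 => p0; have := fp 0; rewrite scale0r addr0 p0 horner0 => ->.
    apply: contraNneq g0 => q0; have := gq 1.
    by rewrite scale1r addrC subrK q0 horner0 => ->.
  have [x _ px] := small_nonroot pq0 ltr01.
  by exists (A + x *: (B - A)); rewrite fp gq -hornerM.
- by move=> C dC; rewrite mulf_eq0 => /norP[/(fP _ dC) ? /(gQ _ dC) ?].
Qed.

Lemma generic_all (T : eqType) (s : seq T) (P : T -> 'M[R]_n -> Prop) :
  (forall x, x \in s -> generic (P x)) ->
  generic (fun A => forall x, x \in s -> P x A).
Proof.
elim: s => [|x s IH] Ps; first exact: generic_true.
apply: (generic_sub _ (generic_and (Ps x (mem_head _ _)) (IH _))).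
  by move=> A _ [Px Pys] y; rewrite inE => /predU1P[->//|]; exact: Pys.
by move=> y ys; apply: Ps; rewrite inE ys orbT.
Qed.

Lemma generic_forall (T : finType) (P : T -> 'M[R]_n -> Prop) :
  (forall x, generic (P x)) -> generic (fun A => forall x, P x A).
Proof.
move=> gP; apply: (generic_sub _ (generic_all (s := enum T) (P := P) _)) => //.
by move=> A _ PA x; apply: PA; rewrite mem_enum.
Qed.

Lemma pos_root k (a : R) : (0 < k)%N -> 0 < a -> exists2 c, 0 < c & c ^+ k = a.
Proof.
move=> k0 a0.
have [||c /andP[c0 _]] := @poly_ivt R ('X^k - a%:P) 0 (1 + a).
- by rewrite addr_ge0// ltW.
- rewrite !hornerE expr0n -[(k == 0)%N]negbK -lt0n k0 /= sub0r oppr_le0 ltW//=.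
  rewrite subr_ge0; apply: (@le_trans _ _ (1 + a)); first by rewrite lerDr.
  by apply: ler_eXnr => //; rewrite lerDl ltW.
rewrite /root !hornerE subr_eq0 => /eqP ck; exists c => //.
rewrite lt_def c0 andbT; apply: contraTneq a0 => c_0.
by rewrite -ck c_0 expr0n -[(k == 0)%N]negbK -lt0n k0 /= ltxx.
Qed.

(** The determinant of [A0] may be zero or negative, and for even [n] no scaling makes a negative
    one equal to 1. A point close to the identity on the line towards [A0] has positive determinant;
    an [n]-th root rescales it into SL, and homogeneity keeps [f] nonzero. *)
Lemma homog_nonzero_SL f k A0 : (0 < n)%N -> polyf f -> homog k f -> f A0 != 0 ->
  exists2 A, \det A = 1 & f A != 0.
Proof.
move=> n0 pf hf fA0.
have pdet : polyf (fun A => \det A) by apply: polyf_det; exact: polyf_mx_id.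
have [dl dl0 detl] := polyf_cont 1%:M pdet (ltr01 : 0 < 1 :> R).
have [q fq] := polyf_line 1%:M (A0 - 1%:M) pf.
have q0 : q != 0.
  apply: contraNneq fA0 => q0; have := fq 1.
  by rewrite scale1r addrC subrK q0 horner0 => ->.
have N0 : 0 < mxN (A0 - 1%:M) + 1 by rewrite ltr_wpDl ?mxN_ge0.
have [t /andP[t0 tdl] qt] := small_nonroot q0 (divr_gt0 dl0 N0).
pose A := 1%:M + t *: (A0 - 1%:M).
have dA : 0 < \det A.
  have : `|\det A - \det (1%:M : 'M[R]_n)| < 1.
    apply: (detl A); rewrite /A addrC addKr mxNZ gtr0_norm//.
    move: tdl; rewrite ltr_pdivlMr//; apply: le_lt_trans.
    by rewrite ler_wpM2l ?ltW// ltrDl.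
  by rewrite det1 ltr_norml; lra.
have dA' : 0 < (\det A)^-1 by rewrite invr_gt0.
have [c c0 cn] := pos_root n0 dA'.
exists (c *: A); first by rewrite detZ cn mulVf// gt_eqF.
by rewrite hf /A fq mulf_neq0// expf_neq0// gt_eqF.
Qed.

Lemma generic_SL (P : 'M[R]_n -> Prop) : (0 < n)%N -> generic P ->
  exists2 A, \det A = 1 & P A.
Proof.
move=> n0 [f [k [pf hf [A0 fA0] fP]]].
have [A dA fA] := homog_nonzero_SL n0 pf hf fA0.
by exists A => //; exact: fP.
Qed.

Lemma generic_mul p q (U : 'M[R]_(p, n)) (V : 'M[R]_(n, q)) :
  U != 0 -> V != 0 -> generic (fun A => U *m A *m V != 0).
Proof.
move=> /matrix0Pn[a [i Uai]] /matrix0Pn[j [b Vjb]].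
exists (fun A => (U *m A *m V) a b), 1%N; split.
- exact: polyf_mx_lin.
- by move=> c A; rewrite -scalemxAr -scalemxAl mxE expr1.
- exists (delta_mx i j); rewrite mxE (bigD1 j)//= big1 ?addr0 => [|k kj].
    rewrite mxE (bigD1 i)//= big1 ?addr0 => [|l li].
      by rewrite !mxE !eqxx mulr1 mulf_neq0.
    by rewrite !mxE (negPf li) mulr0.
  rewrite !mxE big1 ?mul0r// => l _.
  by rewrite !mxE (negPf kj) andbF mulr0.
- by move=> A _; apply: contraNneq => ->; rewrite mxE.
Qed.

(** Inversion is not polynomial, but on determinant 1 it is the adjugate, homogeneous of degree
    [n - 1]. A nonzero is the inverse of a matrix [B] obtained from [generic_mul]. *)
Lemma generic_mulV p q (U : 'M[R]_(p, n)) (V : 'M[R]_(n, q)) :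
  U != 0 -> V != 0 -> generic (fun A => U *m invmx A *m V != 0).
Proof.
move=> U0 V0.
have n0 : (0 < n)%N.
  by case/matrix0Pn: U0 => a [i _]; exact: leq_ltn_trans (ltn_ord i).
have [B dB /matrix0Pn[a [b UBV]]] := generic_SL n0 (generic_mul U0 V0).
exists (fun A => (U *m \adj A *m V) a b), n.-1; split.
- apply: polyf_mxM; last exact: polyf_mx_const.
  by apply: polyf_mxM; [exact: polyf_mx_const|exact: polyf_adj].
- by move=> c A; rewrite adjZ -scalemxAr -scalemxAl mxE.
- have uB : B \in unitmx by rewrite unitmxE dB unitr1.
  exists (invmx B); suff -> : \adj (invmx B) = B by [].
  have := invmxK B; rewrite {1}/invmx unitmx_inv uB det_inv dB !invr1 scale1r.
  by move->.
- move=> A dA; apply: contraNneq.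
  by rewrite /invmx unitmxE dA unitr1 invr1 scale1r => ->; rewrite mxE.
Qed.

End PolynomialFunctions.

(** * Generic elements of a Zariski-dense subgroup *)

Lemma toPSL_scale (R : fieldType) (d : nat) (g h : SL R d) : (0 < d)%N ->
  toPSL g = toPSL h -> exists2 a, a != 0 & val h = a *: val g.
Proof.
move=> d0 /eqP; rewrite toPSL_eq => /is_scalar_mxP[a gha]; exists a.
  have : \det (val (g^-1 * h)%g) != 0.
    by rewrite (eqP (valP (g^-1 * h)%g)) oner_neq0.
  by rewrite gha det_scalar expf_eq0 d0.
rewrite -mul_mx_scalar -gha SL_valM SL_valV mulKVmx//.
by rewrite unitmxE (eqP (valP g)) unitr1.
Qed.

Lemma zariski_dense_generic (R : realType) (d : nat) (X : set (PSL R d))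
    (P : 'M[R]_d -> Prop) :
  (0 < d)%N -> zariski_dense X -> generic P ->
  exists2 g : SL R d, X (toPSL g) & P (val g).
Proof.
move=> d0 dX [f [k [pf hf [A0 fA0] fP]]]; apply: contrapT => /forall2NP noP.
have f0 (g : SL R d) : X (toPSL g) -> f (val g) = 0.
  move=> Xg; have [//|Pg] := noP g; apply/eqP/negPn/negP => fg.
  by apply/Pg/fP => //; exact/eqP/(valP g).
have f_repr (g : SL R d) : (f (val (repr (toPSL g))) == 0) = (f (val g) == 0).
  have [a a0 ->] := toPSL_scale d0 (toPSL_repr (toPSL g)).
  by rewrite hf mulf_eq0 expf_eq0 (negPf a0) andbF.
have [p fp] := polyf_mpoly pf.
(* [f] is no function on PSL, but by homogeneity its vanishing does not depend on the
   representative, so it may be tested on [repr]. *)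
have Zc : PSL_zariski_closed [set x : PSL R d | f (val (repr x)) = 0].
  exists [set p]; apply/seteqP; split=> [g /= /eqP|g /= /(_ p erefl)].
    by rewrite f_repr => /eqP fg _ ->; rewrite -fp.
  by rewrite -fp => /eqP fg; apply/eqP; rewrite f_repr.
have ZT : [set x : PSL R d | f (val (repr x)) = 0] = setT.
  by apply: dX => // x Xx; apply: f0; rewrite toPSL_repr.
have [A dA /negP] := homog_nonzero_SL d0 pf hf fA0; apply.
have dA' : \det A == 1 by rewrite dA.
have : [set x : PSL R d | f (val (repr x)) = 0] (toPSL (Sub A dA')) by rewrite ZT.
by move/eqP; rewrite f_repr SubK.
Qed.

(** * Invariant forms of bounded semigroups *)

Section InvariantForm.
Variable R : realType.

Definition mxsq m n (A : 'M[R]_(m, n)) : R := \sum_i \sum_j A i j ^+ 2.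

Lemma mxsq_ge0 m n (A : 'M[R]_(m, n)) : 0 <= mxsq A.
Proof. by do 2!apply: sumr_ge0 => ? _; exact: sqr_ge0. Qed.

Lemma mxsq_le m n (A : 'M[R]_(m, n)) : mxsq A <= mxN A ^+ 2.
Proof.
rewrite expr2 {2}/mxN mulr_suml; apply: ler_sum => i _.
rewrite mulr_suml; apply: ler_sum => j _.
by rewrite -real_normK ?num_real// expr2 ler_wpM2l ?mxN_ge0// ler_mxN.
Qed.

(** Cauchy-Schwarz, by summing [2 t |A i j| <= t ^+ 2 + A i j ^+ 2] with [t] essentially the mean of
    the [|A i j|]. The [+ 1] keeps the divisor positive for an empty matrix. *)
Lemma mxN_sq_le m n (A : 'M[R]_(m, n)) :
  mxN A ^+ 2 <= ((m * n)%:R + 1) * mxsq A.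
Proof.
pose M : R := (m * n)%:R + 1; rewrite -/M.
have M1 : 1 <= M by rewrite lerDr.
have M0 : 0 < M by exact: lt_le_trans M1.
pose t := mxN A / M.
have : \sum_i \sum_j 2 * t * `|A i j| <= \sum_(i < m) \sum_(j < n) (t ^+ 2 + A i j ^+ 2).
  apply: ler_sum => i _; apply: ler_sum => j _.
  have := sqr_ge0 (t - `|A i j|); rewrite -(real_normK (num_real (A i j))).
  by rewrite sqrrB; lra.
under eq_bigr do rewrite -mulr_sumr; rewrite -mulr_sumr -/(mxN A).
under [X in _ <= X]eq_bigr do rewrite big_split /= sumr_const card_ord.
rewrite big_split /= sumr_const card_ord -/(mxsq A) -mulrnA mulnC -(mulr_natr (t ^+ 2)).
have -> : (m * n)%:R = M - 1 by rewrite /M addrK.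
have tM : mxN A = t * M by rewrite /t mulfVK ?gt_eqF.
rewrite tM => h.
have t2 : 0 <= t ^+ 2 by exact: sqr_ge0.
have h1 : t ^+ 2 * M <= mxsq A by nra.
have -> : (t * M) ^+ 2 = M * (t ^+ 2 * M) by ring.
by rewrite ler_pM2l.
Qed.

Lemma mxsq_parallelogram m n (A B : 'M[R]_(m, n)) :
  mxsq (2^-1 *: (A + B)) + mxsq (2^-1 *: (A - B)) = (mxsq A + mxsq B) / 2.
Proof.
rewrite /mxsq -!big_split mulr_suml; apply: eq_bigr => i _.
rewrite -!big_split mulr_suml; apply: eq_bigr => j _ /=.
by rewrite !mxE; field.
Qed.

Lemma mxN_tr m n (A : 'M[R]_(m, n)) : mxN A^T = mxN A.
Proof.
by rewrite /mxN exchange_big; do 2!apply: eq_bigr => ? _; rewrite mxE.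
Qed.

(* The forms [S] bounded below on all [K]-orbits by a fixed multiple of the
   norm are a [K]-stable closed convex set; by the parallelogram law,
   [S |-> sup_k |k^T S k|^2] has a unique minimiser on it. *)
Lemma invariant_form n (K : set 'M[R]_n) (C : R) : 0 < C ->
  K 1%:M -> (forall k l, K k -> K l -> K (k *m l)) ->
  (forall k, K k -> mxN k <= C) ->
  (forall k, K k -> exists2 k', k' *m k = 1%:M & mxN k' <= C) ->
  exists2 Q : 'M[R]_n,
    forall x : 'cV_n, x != 0 -> 0 < (x^T *m Q *m x) 0 0 &
    forall k, K k -> k^T *m Q *m k = Q.
Proof.
move=> C0 K1 KM KC KV.
(* Chosen so that the identity satisfies [X]: a left inverse of [k] bounded by [C] gives
   [mxN x <= C * mxN (k *m x)], and the other factor compares [mxN] with the Euclidean norm. *)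
pose kap := (((n * 1)%:R + 1) * C ^+ 2)^-1.
have kap0 : 0 < kap by rewrite invr_gt0 mulr_gt0// ?exprn_gt0// ltr_wpDl.
pose X (S : 'M[R]_n) := forall k (x : 'cV_n), K k ->
  kap * mxN x ^+ 2 <= ((k *m x)^T *m S *m (k *m x)) 0 0.
have X1 : X 1%:M.
  move=> k x /KV[k' k'k k'C]; rewrite mulmx1.
  have -> : ((k *m x)^T *m (k *m x)) 0 0 = mxsq (k *m x).
    by rewrite mxE; apply: eq_bigr => i _; rewrite big_ord1 mxE expr2.
  have Nx : mxN x <= C * mxN (k *m x).
    rewrite -{1}(mul1mx x) -k'k -mulmxA; apply: le_trans (mxNM _ _) _.
    by rewrite ler_wpM2r ?mxN_ge0.
  rewrite mulrC ler_pdivrMr ?mulr_gt0// ?exprn_gt0// ?ltr_wpDl//.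
  apply: le_trans (_ : (C * mxN (k *m x)) ^+ 2 <= _).
    by rewrite lerXn2r ?nnegrE ?mulr_ge0// ltW.
  rewrite exprMn; apply: le_trans (ler_wpM2l (sqr_ge0 C) (mxN_sq_le _)) _.
  by rewrite le_eqVlt; apply/orP; left; apply/eqP; ring.
have Xl S l : K l -> X S -> X (l^T *m S *m l).
  move=> Kl XS k x Kk; have := XS (l *m k) x (KM _ _ Kl Kk).
  by rewrite !trmx_mul !mulmxA.
have Xcvx S T : X S -> X T -> X (2^-1 *: (S + T)).
  move=> XS XT k x Kk; rewrite -scalemxAr -scalemxAl mulmxDr mulmxDl.
  rewrite [leRHS]mxE [X in _ <= _ * X]mxE.
  by have := XS k x Kk; have := XT k x Kk; lra.
pose ub v S := forall k, K k -> mxsq (k^T *m S *m k) <= v.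
pose V := [set v | exists2 S, X S & ub v S].
have VI : has_inf V.
  split; last by exists 0 => v [S _ /(_ _ K1)]; apply: le_trans (mxsq_ge0 _).
  exists (C ^+ 2 ^+ 2); exists 1%:M => // k Kk.
  rewrite mulmx1; apply: le_trans (mxsq_le _) _.
  rewrite lerXn2r ?nnegrE ?sqr_ge0//; apply: le_trans (mxNM _ _) _.
  by rewrite mxN_tr expr2 ler_pM// KC.
pose mu := inf V.
pose P e S := X S /\ ub (mu + e) S.
have Pmono e e' S : 0 < e -> e <= e' -> P e S -> P e' S.
  move=> _ ee' [XS uS]; split=> // k Kk; apply: le_trans (uS k Kk) _.
  by rewrite lerD2l.
have [S0 clS0] : exists S0, forall e, 0 < e -> exists2 S, P e S & mxN (S - S0) < e.
  apply: (@mx_cluster _ _ _ (1 + ((n * n)%:R + 1) * (mu + 1))) => // e e0.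
  have e10 : 0 < Num.min e 1 by rewrite lt_min e0 ltr01.
  have [v [S XS uS] vmu] := inf_adherent e10 VI.
  have PS : P (Num.min e 1) S.
    by split=> // k Kk; apply: le_trans (uS k Kk) (ltW vmu).
  exists S; first by apply: Pmono PS => //; rewrite ge_min lexx.
  have : mxsq S <= mu + 1.
    have := PS.2 _ K1; rewrite trmx1 mul1mx mulmx1 => /le_trans; apply.
    by rewrite lerD2l ge_min lexx orbT.
  have M0 : 0 < (n * n)%:R + 1 :> R by rewrite ltr_wpDl.
  rewrite -(ler_pM2l M0); have := mxN_sq_le S; have := sqr_ge0 (mxN S - 1).
  have := mxN_ge0 S; nra.
have XS0 : X S0.
  move=> k x Kk; rewrite -lerN2.
  apply: (polyf_le_cluster (P := P) (L := S0)
    (f := fun S => - ((k *m x)^T *m S *m (k *m x)) 0 0)) => //.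
    by apply: polyfN; exact: polyf_mx_lin.
  by move=> e S e0 [XS _] /=; have := XS k x Kk; lra.
have uS0 : ub mu S0.
  move=> k Kk.
  apply: (polyf_le_cluster (P := P) (L := S0)
    (f := fun S => mxsq (k^T *m S *m k))) => //.
    do 2!apply: polyf_sum => ?; under eq_fun do rewrite expr2.
    by apply: polyfM; exact: polyf_mx_lin.
  by move=> e S e0 [_]; exact.
exists S0 => [x x0|l Kl].
  have := XS0 _ x K1; rewrite mul1mx; apply: lt_le_trans.
  by rewrite mulr_gt0// exprn_gt0// mxN_gt0.
pose S1 := l^T *m S0 *m l.
have uS1 : ub mu S1.
  by move=> k Kk; have := uS0 _ (KM _ _ Kl Kk); rewrite trmx_mul !mulmxA.
(* Since inverses are bounded by [C], [c] bounds the norm of [k^T Z k] from below for all [k] in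
   [K], where [Z] is half of [S1 - S0]. By the parallelogram law the midpoint then beats the infimum
   by [e], unless [c = 0]. *)
pose c := mxN (2^-1 *: (S1 - S0)) / C ^+ 2.
have c_ge0 : 0 <= c by rewrite divr_ge0// ltW// exprn_gt0.
pose e := ((n * n)%:R + 1)^-1 * c ^+ 2.
have M0 : 0 < ((n * n)%:R + 1 : R) by rewrite ltr_wpDl.
have uT : ub (mu - e) (2^-1 *: (S1 + S0)).
  move=> k Kk.
  have := mxsq_parallelogram (k^T *m S1 *m k) (k^T *m S0 *m k).
  have Z2 Y : 2^-1 *: (k^T *m Y *m k) = k^T *m (2^-1 *: Y) *m k.
    by rewrite -scalemxAr -scalemxAl.
  rewrite -!(mulmxDl, mulmxBl, mulmxDr, mulmxBr) !Z2.
  have := uS1 _ Kk; have := uS0 _ Kk.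
  suff : e <= mxsq (k^T *m (2^-1 *: (S1 - S0)) *m k) by lra.
  rewrite /e mulrC ler_pdivrMr// mulrC; apply: le_trans (mxN_sq_le _).
  rewrite lerXn2r ?nnegrE// /c ler_pdivrMr ?exprn_gt0//.
  have [k' k'k k'C] := KV _ Kk.
  set Z := 2^-1 *: _.
  have {1}-> : Z = k'^T *m (k^T *m Z *m k) *m k'.
    have k'kT : k'^T *m k^T = 1%:M.
      by rewrite -trmx_mul -trmx1; congr trmx; exact: mulmx1C k'k.
    by rewrite !mulmxA k'kT mul1mx -mulmxA (mulmx1C k'k) mulmx1.
  apply: le_trans (mxNM _ _) _; rewrite expr2 mulrA ler_pM//.
  apply: le_trans (mxNM _ _) _; rewrite mulrC mxN_tr ler_wpM2l ?mxN_ge0//.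
have := ge_inf VI.2 (ex_intro2 _ _ _ (Xcvx _ _ (Xl _ _ Kl XS0) XS0) uT : V (mu - e)).
rewrite -/mu => h.
have : c ^+ 2 <= 0.
  have : e <= 0 by lra.
  by rewrite /e pmulr_rle0 ?invr_gt0.
rewrite real_exprn_even_le0 ?num_real// => /= /eqP.
rewrite /c => /eqP; rewrite mulf_eq0 invr_eq0 expf_eq0 (gt_eqF C0) /= orbF.
by rewrite mxN_eq0 scaler_eq0 invr_eq0 pnatr_eq0 /= subr_eq0 => /eqP.
Qed.
End InvariantForm.

(** * Rank one limits *)

Lemma trmx_formZ (R : comPzRingType) n (c : R) (Q A : 'M[R]_n) :
  (c *: A)^T *m Q *m (c *: A) = c ^+ 2 *: (A^T *m Q *m A).
Proof.
have -> : (c *: A)^T = c *: A^T by apply/matrixP => i j; rewrite !mxE.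
by rewrite -scalemxAr -!scalemxAl scalerA expr2.
Qed.

Lemma polyf_bounded (R : realType) n (f : 'M[R]_n -> R) (C : R) : polyf f ->
  exists B, forall A, mxN A <= C -> `|f A| <= B.
Proof.
elim=> [c|i j|{}f g _ [a fa] _ [b gb]|{}f g _ [a fa] _ [b gb]].
- by exists `|c|.
- by exists C => A; apply: le_trans; exact: ler_mxN.
- exists (a + b) => A AC; apply: le_trans (ler_normD _ _) _.
  by rewrite lerD ?fa ?gb.
- by exists (a * b) => A AC; rewrite normrM ler_pM ?fa ?gb.
Qed.

Lemma adj_bounded (R : realType) n (C : R) :
  exists B, forall A : 'M[R]_n, mxN A <= C -> mxN (\adj A) <= B.
Proof.
have /choice[b bP] : forall ij : 'I_n * 'I_n, exists b, forall A : 'M[R]_n,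
    mxN A <= C -> `|\adj A ij.1 ij.2| <= b.
  by move=> [i j]; apply: polyf_bounded; exact: polyf_adj.
exists (\sum_i \sum_j b (i, j)) => A AC.
by apply: ler_sum => i _; apply: ler_sum => j _; exact: (bP (i, j)).
Qed.

(** The interface between PSL and matrices: Zariski density enters the dynamics only through
    [dense_groupP]. *)
Record dense_group (R : realType) d (G : set 'M[R]_d) : Prop := DenseGroup {
  dense_group1 : G 1%:M;
  dense_groupM : forall A B, G A -> G B -> G (A *m B);
  dense_groupV : forall A, G A -> G (invmx A);
  dense_group_det : forall A, G A -> \det A = 1;
  dense_groupP : forall P, generic P -> exists2 A, G A & P A }.

Section ClosedCone.
Variables (R : realType) (d : nat) (G : set 'M[R]_d).
Hypothesis dG : dense_group G.

(** The closure of the scalar multiples of [G]; its nonzero elements represent the projective limits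
    of the group, among which the rank may drop. *)
Definition clcone (B : 'M[R]_d) :=
  forall e, 0 < e -> exists c A, G A /\ mxN (B - c *: A) < e.

Lemma clcone_sub A : G A -> clcone A.
Proof. by move=> GA e e0; exists 1, A; rewrite scale1r subrr mxN0. Qed.

Lemma clcone_closed B :
  (forall e, 0 < e -> exists2 A, clcone A & mxN (A - B) < e) -> clcone B.
Proof.
move=> clB e e0; have e20 : 0 < e / 2 by rewrite divr_gt0.
have [A clA AB] := clB _ e20; have [c [A' [GA' AA']]] := clA _ e20.
exists c, A'; split=> //; rewrite -(subrKA A).
apply: le_lt_trans (mxND _ _) _; rewrite mxN_distC; lra.
Qed.

Lemma clconeZ a B : clcone B -> clcone (a *: B).
Proof.
move=> clB e e0; have a0 : 0 < `|a| + 1 by rewrite ltr_wpDl.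
have [c [A [GA BA]]] := clB (e / (`|a| + 1)) (divr_gt0 e0 a0).
exists (a * c), A; split=> //; rewrite -scalerA -scalerBr mxNZ.
move: BA; rewrite ltr_pdivlMr//; apply: le_lt_trans.
by rewrite mulrC ler_wpM2l// lerDl.
Qed.

Lemma clconeM A B : clcone A -> clcone B -> clcone (A *m B).
Proof.
move=> clA clB e e0; pose M := mxN A + mxN B + 1.
have M0 : 0 < M by rewrite ltr_wpDl// addr_ge0.
pose e1 := Num.min 1 (e / (2 * M)).
have e10 : 0 < e1 by rewrite lt_min ltr01 divr_gt0// mulr_gt0.
have e11 : e1 <= 1 by rewrite ge_min lexx.
have e1M : e1 * M <= e / 2.
  by rewrite -ler_pdivlMr// ge_min -mulrA -invfM lexx orbT.
have [a [A' [GA' AA']]] := clA _ e10; have [b [B' [GB' BB']]] := clB _ e10.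
exists (a * b), (A' *m B'); split; first exact: dense_groupM.
have -> : A *m B - (a * b) *: (A' *m B') =
    A *m (B - b *: B') + (A - a *: A') *m (b *: B').
  by rewrite mulmxBr mulmxBl addrA subrK -scalemxAl -scalemxAr scalerA.
apply: le_lt_trans (mxND _ _) _.
have h1 := mxNM A (B - b *: B'); have h2 := mxNM (A - a *: A') (b *: B').
have h3 : mxN (b *: B') <= mxN B + e1.
  apply: le_trans (mxN_triang _ B) _; rewrite lerD2l mxN_distC; exact: ltW.
have h4 : mxN A * mxN (B - b *: B') <= mxN A * e1 by rewrite ler_wpM2l// ltW.
have h5 : mxN (A - a *: A') * mxN (b *: B') <= e1 * (mxN B + 1).
  by rewrite ler_pM//; [exact: ltW|apply: le_trans h3 _; rewrite lerD2l].
rewrite /M in e1M; lra.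
Qed.

Lemma clcone_min_rank : (0 < d)%N -> exists2 B, clcone B /\ B != 0 &
  forall A, clcone A -> A != 0 -> (\rank B <= \rank A)%N.
Proof.
move=> d0.
have ex : exists r, `[< exists2 B, clcone B /\ B != 0 & \rank B = r >].
  exists (\rank (1%:M : 'M[R]_d)); apply/asboolP; exists 1%:M => //.
  split; first exact: clcone_sub (dense_group1 dG).
  by rewrite -mxrank_eq0 mxrank1 -lt0n.
case: (ex_minnP ex) => r /asboolP[B ? <-] minB; exists B => // A clA A0.
by apply: minB; apply/asboolP; exists A.
Qed.

(* In a limit [pi = P Phi] of minimal rank r, the compressions of the cone to
   the image of [pi] are zero or invertible, so their normalisations form a
   bounded semigroup, which preserves a definite form [Q]. Being similitudes
   of [Q] is an algebraic condition, so density extends it to all r x r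
   matrices, which is absurd unless r = 1. *)
Lemma clcone_rank1 : (0 < d)%N -> exists2 B, clcone B & \rank B = 1%N.
Proof.
move=> d0; have [pi [clpi pi0] pimin] := clcone_min_rank d0.
exists pi => //.
pose P := col_base pi; pose Phi := row_base pi; set r := \rank pi in P Phi *.
have PPhi : P *m Phi = pi by exact: mulmx_base.
have LP : pinvmx P *m P = 1%:M by rewrite mulVpmx// col_base_full.
have PhiR : Phi *m pinvmx Phi = 1%:M by rewrite mulmxVp// row_base_free.
have r0 : (0 < r)%N by rewrite lt0n mxrank_eq0.
have rankPPhi k : \rank (P *m k *m Phi) = \rank k.
  by rewrite mxrankMfree ?row_base_free// (eqmxMfull _ (col_base_full pi)).
(* A singular nonzero [k] would give a nonzero cone element of rank below the minimum [r]. *)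
have unitP k : clcone (P *m k *m Phi) -> k != 0 -> k \in unitmx.
  move=> clk k0; rewrite -row_free_unit -row_leq_rank -rankPPhi pimin//.
  by rewrite -mxrank_eq0 rankPPhi mxrank_eq0.
have P0 : P != 0 by apply: contraNneq pi0 => P0; rewrite -PPhi P0 mul0mx.
have Phi0 : Phi != 0 by apply: contraNneq pi0 => h; rewrite -PPhi h mulmx0.
have [g Gg h0] := dense_groupP dG (generic_mul Phi0 P0).
pose h := Phi *m g *m P.
have cl_compress A : G A -> clcone (P *m (Phi *m A *m P) *m Phi).
  move=> GA; have -> : P *m (Phi *m A *m P) *m Phi = P *m Phi *m A *m (P *m Phi).
    by rewrite !mulmxA.
  by rewrite PPhi; do 2?apply: clconeM => //; exact: clcone_sub.
have uh : h \in unitmx by apply: unitP; rewrite ?h0//; exact: cl_compress.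
(* Two cone elements joined by [g] produce the middle factor [Phi *m g *m P], that is [h]; the twist
   by [invmx h] cancels it, so that [S] is stable under plain multiplication. *)
pose S k := clcone (P *m (k *m invmx h) *m Phi).
have Sunit k : S k -> k != 0 -> k \in unitmx.
  move=> Sk k0; rewrite -(mulmxKV uh k) unitmx_mul uh andbT unitP//.
  by apply: contraNneq k0 => k0; rewrite -(mulmxKV uh k) k0 mul0mx.
have SM k l : S k -> S l -> S (k *m l).
  move=> Sk Sl; have := clconeM (clconeM Sk (clcone_sub Gg)) Sl.
  have -> : P *m (k *m invmx h) *m Phi *m g *m (P *m (l *m invmx h) *m Phi) =
      P *m (k *m invmx h *m h *m (l *m invmx h)) *m Phi by rewrite /h !mulmxA.
  by rewrite mulmxKV// mulmxA.
have SZ c k : S k -> S (c *: k).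
  by rewrite /S -scalemxAl -scalemxAr -scalemxAl; exact: clconeZ.
have SG A : G A -> S (Phi *m A *m P *m h).
  by move=> GA; rewrite /S mulmxK//; exact: cl_compress.
have Sclosed (L : 'M[R]_r) : (forall e : R, 0 < e -> exists2 k, S k & mxN (k - L) < e) -> S L.
  move=> clL; apply: clcone_closed => e e0.
  pose c := mxN P * (mxN (invmx h) * mxN Phi) + 1.
  have c0 : 0 < c by rewrite ltr_wpDl// !mulr_ge0.
  have [k Sk kL] := clL _ (divr_gt0 e0 c0).
  exists (P *m (k *m invmx h) *m Phi) => //.
  rewrite -mulmxBl -mulmxBr -mulmxBl.
  move: kL; rewrite ltr_pdivlMr//; apply: le_lt_trans.
  apply: le_trans (mxNM _ _) _.
  apply: (@le_trans _ _ (mxN P * (mxN (k - L) * mxN (invmx h)) * mxN Phi)).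
    rewrite ler_wpM2r//; apply: le_trans (mxNM _ _) _.
    by rewrite ler_wpM2l// mxNM.
  have := mxN_ge0 (k - L); rewrite /c; nra.
(* The identity is adjoined because [invariant_form] asks for it and it is not clear that [S]
   contains it. *)
pose K := [set k : 'M[R]_r | k = 1%:M \/ (S k /\ `|\det k| = 1)].
(* If [K] were unbounded, its elements rescaled to norm 1 would have determinants of size
   [mxN k ^- r], tending to 0, and would cluster at a singular nonzero element of [S]. *)
have [C1 KC1] : exists C, forall k, K k -> mxN k <= C.
  apply: contrapT => /forallNP unb.
  pose Pr (e : R) (A : 'M[R]_r) : Prop := [/\ S A, mxN A = 1 & `|\det A| <= e].
  have Prm (e e' : R) A : 0 < e -> e <= e' -> Pr e A -> Pr e' A.
    by move=> _ ee' [? ? h1]; split=> //; exact: le_trans ee'.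
  have [|L clL] := @mx_cluster R r r 1 Pr Prm.
    (* Large enough to exclude the identity and to force both [1 < mxN k] and [e^-1 <= mxN k]. *)
    move=> e e0; pose T : R := 1 + e^-1 + mxN (1%:M : 'M[R]_r).
    have /existsNP[k /not_implyP[Kk /negP]] := unb T; rewrite -ltNge => Tk.
    have eV0 : 0 < e^-1 by rewrite invr_gt0.
    have T0 : 0 <= mxN (1%:M : 'M[R]_r) by [].
    have k1 : 1 < mxN k by rewrite /T in Tk; lra.
    have kgt0 : 0 < mxN k by lra.
    have [ke|[Sk dk]] := Kk.
      have : (0 : R) < 0 by rewrite /T -ke in Tk; lra.
      by rewrite ltxx.
    exists ((mxN k)^-1 *: k); last first.
      by rewrite mxNZ normfV gtr0_norm// mulVf// gt_eqF.
    split; first exact: SZ.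
      by rewrite mxNZ normfV gtr0_norm// mulVf// gt_eqF.
    rewrite detZ normrM dk mulr1 normrX normfV gtr0_norm// exprVn.
    rewrite -[leRHS]invrK lef_pV2 ?posrE ?exprn_gt0//.
    apply: (@le_trans _ _ (mxN k)); first by rewrite /T in Tk; lra.
    by apply: ler_eXnr => //; exact: ltW.
  have SL : S L.
    by apply: Sclosed => e e0; have [k [Sk _ _] kL] := clL e e0; exists k.
  have L0 : L != 0.
    apply/eqP => L0; have [k [_ k1 _]] := clL 1 ltr01.
    by rewrite L0 subr0 k1 ltxx.
  have pdet : polyf (fun A : 'M[R]_r => \det A).
    by apply: polyf_det; exact: polyf_mx_id.
  have dL : \det L = 0.
    apply/eqP; rewrite eq_le -oppr_le0; apply/andP; split.
      apply: (polyf_le_cluster pdet Prm clL) => e A e0 [_ _].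
      by rewrite add0r; apply: le_trans; exact: ler_norm.
    apply: (polyf_le_cluster (polyfN pdet) Prm clL) => e A e0 [_ _].
    by rewrite add0r; apply: le_trans; rewrite -normrN; exact: ler_norm.
  by have := Sunit _ SL L0; rewrite unitmxE dL unitr0.
have [C2 KC2] := adj_bounded r C1.
have KM k l : K k -> K l -> K (k *m l).
  move=> [->|[Sk dk]]; first by rewrite mul1mx.
  move=> [->|[Sl dl]]; first by rewrite mulmx1; right.
  by right; split; [exact: SM|rewrite det_mulmx normrM dk dl mulr1].
have K1 : K 1%:M by left.
have KV k : K k -> exists2 k', k' *m k = 1%:M & mxN k' <= C2.
  move=> Kk; have dk : `|\det k| = 1.
    by case: Kk => [->|[]//]; rewrite det1 normr1.
  have uk : k \in unitmx by rewrite unitmxE unitfE -normr_gt0 dk.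
  exists (invmx k); first exact: mulVmx.
  by rewrite /invmx uk mxNZ normfV dk invr1 mul1r KC2// KC1.
pose C := `|C1| + `|C2| + 1.
have C0 : 0 < C by rewrite ltr_wpDl// addr_ge0.
have KC k : K k -> mxN k <= C.
  move=> Kk; apply: le_trans (KC1 _ Kk) _.
  by rewrite /C; have := ler_norm C1; have := normr_ge0 C2; lra.
have KVC k : K k -> exists2 k', k' *m k = 1%:M & mxN k' <= C.
  move=> /KV[k' k'k k'C]; exists k' => //; apply: le_trans k'C _.
  by rewrite /C; have := ler_norm C2; have := normr_ge0 C1; lra.
have [Q Qpos QK] := invariant_form C0 K1 KM KC KVC.
apply/eqP; rewrite eqn_leq r0 andbT leqNgt; apply/negP => r1.
pose i0 := Ordinal r0; pose i1 := Ordinal r1.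
pose s A := Phi *m A *m (P *m h).
(* For a similitude [s] of [Q] the form [s^T Q s] is proportional to [Q]. Comparing two diagonal
   entries, available since [1 < r], turns this into one quadratic equation. *)
pose f A := ((s A)^T *m Q *m s A) i0 i0 * Q i1 i1
  - ((s A)^T *m Q *m s A) i1 i1 * Q i0 i0.
have ps : polyf_mx s by exact: polyf_mx_lin.
have pq : polyf_mx (fun A => (s A)^T *m Q *m s A).
  do 2?apply: polyf_mxM => //; [exact: polyf_mxT|exact: polyf_mx_const].
have fgen : generic (fun A => f A != 0).
  exists f, 2%N; split=> //.
  - by apply: polyfD; [|apply: polyfN]; apply: polyfM => //; exact: polyf_const.
  - move=> c A; rewrite /f; have -> : s (c *: A) = c *: s A.
      by rewrite /s -scalemxAr -scalemxAl.
    rewrite trmx_formZ.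
    by rewrite [X in X * _ - _]mxE [X in _ - X * _]mxE; ring.
  (* A preimage under [s] of a matrix unit, whose form has a single nonzero entry, at [(i0, i0)]. *)
  - exists (pinvmx Phi *m delta_mx i0 i0 *m (invmx h *m pinvmx P)).
    rewrite /f; have -> : s (pinvmx Phi *m delta_mx i0 i0 *m (invmx h *m pinvmx P)) =
        delta_mx i0 i0.
      transitivity (Phi *m pinvmx Phi *m delta_mx i0 i0 *m
          (invmx h *m (pinvmx P *m P) *m h)); first by rewrite /s !mulmxA.
      by rewrite PhiR LP mul1mx mulmx1 mulVmx// mulmx1.
    have Qii i : 0 < Q i i.
      have /Qpos : delta_mx i 0 != 0 :> 'cV[R]_r.
        by apply/matrix0Pn; exists i, 0; rewrite mxE !eqxx oner_neq0.
      by rewrite trmx_delta -rowE -colE !mxE.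
    rewrite trmx_delta; have -> : delta_mx i0 i0 *m Q *m delta_mx i0 i0 =
        Q i0 i0 *: delta_mx i0 i0.
      apply/matrixP => i j; rewrite -mulmxA mxE (bigD1 i0)//= big1 ?addr0.
        rewrite [X in _ * X]mxE (bigD1 i0)//= big1 ?addr0; last first.
          by move=> k /negPf ki; rewrite !mxE ki mulr0.
        by rewrite !mxE !eqxx /= andbT; case: (i == i0); case: (j == i0);
          rewrite ?(mul1r, mulr1, mulr0, mul0r).
      by move=> k /negPf ki; rewrite !mxE ki andbF mul0r.
    by rewrite !mxE !eqxx /= mulr1 mulr0 mul0r subr0 mulf_neq0// gt_eqF.
have [A GA] := dense_groupP dG fgen; apply/negP/negPn/eqP.
rewrite /f; set k := s A; have Sk : S k by rewrite /k /s mulmxA; exact: SG.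
have [->|k0] := eqVneq k 0; first by rewrite !mulmx0 !mxE !mul0r subr0.
have dk : 0 < `|\det k|^-1.
  by rewrite invr_gt0 normr_gt0 -unitfE -unitmxE Sunit.
have [c c0 cr] := pos_root r0 dk.
have Kck : K (c *: k).
  right; split; first exact: SZ.
  by rewrite detZ normrM normrX (gtr0_norm c0) cr mulVf// -invr_eq0 gt_eqF.
have kQk : k^T *m Q *m k = (c ^- 2) *: Q.
  rewrite -{2}(QK _ Kck) trmx_formZ scalerA.
  by rewrite mulVf ?scale1r// expf_neq0// gt_eqF.
by rewrite kQk !mxE; ring.
Qed.

End ClosedCone.

Lemma exists_coker (R : fieldType) m d (A : 'M[R]_(m, d)) : (\rank A < d)%N ->
  exists2 v : 'cV[R]_d, v != 0 & A *m v = 0.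
Proof.
rewrite -subn_gt0 -mxrank_coker lt0n mxrank_eq0 => /matrix0Pn[i [j cij]].
exists (col j (cokermx A)); last by rewrite colE mulmxA mulmx_coker mul0mx.
by apply: contraNneq cij => /matrixP/(_ i 0); rewrite !mxE => ->.
Qed.

Lemma mulmx1_invmx (R : comUnitRingType) n (A B : 'M[R]_n) :
  A *m B = 1%:M -> invmx A = B.
Proof.
by move=> AB; have [uA _] := mulmx1_unit AB; rewrite -[RHS](mulKmx uA) AB mulmx1.
Qed.

Lemma rank1_mul (R : fieldType) m n (A : 'M[R]_(m, n)) : \rank A = 1%N ->
  exists (p : 'cV[R]_m) (phi : 'rV[R]_n), A = p *m phi.
Proof.
rewrite -{2}(mulmx_base A).
by move: (col_base A) (row_base A); move: (\rank A) => r P Phi r1; subst r;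
   exists P, Phi.
Qed.

Lemma ger_eps (R : realType) (x K : R) :
  (forall e, 0 < e -> e <= 1 -> x <= K * e) -> x <= 0.
Proof.
move=> h; apply/ler_addgt0Pr => e e0; rewrite add0r.
have K0 : 0 < `|K| + 1 by rewrite ltr_wpDl.
pose e1 := Num.min 1 (e / (`|K| + 1)).
have e10 : 0 < e1 by rewrite lt_min ltr01 divr_gt0.
apply: le_trans (h e1 e10 _) _; first by rewrite ge_min lexx.
apply: (@le_trans _ _ ((`|K| + 1) * e1)).
  by rewrite ler_wpM2r ?(ltW e10)//; have := ler_norm K; lra.
by rewrite mulrC -ler_pdivlMr// ge_min lexx orbT.
Qed.

Definition rank1_approx (R : realType) d (p : 'cV[R]_d) (phi psi : 'rV[R]_d)
    (e : R) (s : 'M[R]_d) :=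
  exists c c', mxN (c *: s - p *m phi) < e /\ mxN (c' *: invmx s - p *m psi) < e.

Section RankOnePair.
Variables (R : realType) (d : nat) (G : set 'M[R]_d).
Hypothesis dG : dense_group G.

Lemma dense_group_unit A : G A -> A \in unitmx.
Proof. by move=> GA; rewrite unitmxE (dense_group_det dG GA) unitr1. Qed.

(* If [c a] and [c' a^-1] tend to [p phi0] and [L], then the rescaled
   [a g a^-1] and its inverse tend to [p (phi0 g L)] and [p (phi0 g^-1 L)]. *)
Lemma rank1_pair : (0 < d)%N -> exists (p : 'cV[R]_d) (phi psi : 'rV[R]_d),
  [/\ p != 0, phi != 0, psi != 0 &
      forall e, 0 < e -> exists2 s, G s & rank1_approx p phi psi e s].
Proof.
move=> d0; have [pi clpi rpi] := clcone_rank1 dG d0.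
have pi0 : pi != 0 by rewrite -mxrank_eq0 rpi.
have [p [phi0 piE]] := rank1_mul rpi.
have p0 : p != 0 by apply: contraNneq pi0 => p0; rewrite piE p0 mul0mx.
have phi00 : phi0 != 0 by apply: contraNneq pi0 => h; rewrite piE h mulmx0.
(* Each normalised inverse [B] remembers an [a] that is close to [pi] up to scaling, so that a
   cluster point [L] comes with elements controlled on both sides. *)
pose Pr (e : R) (B : 'M[R]_d) : Prop := mxN B = 1 /\
  exists a c c', [/\ G a, mxN (c *: a - pi) < e & B = c' *: invmx a].
have Prm (e e' : R) B : 0 < e -> e <= e' -> Pr e B -> Pr e' B.
  move=> _ ee' [NB [a [c [c' [Ga ca Ba]]]]]; split=> //; exists a, c, c'.
  by split=> //; exact: lt_le_trans ee'.
have [|L clL] := @mx_cluster R d d 1 Pr Prm.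
  move=> e e0; have [c [a [Ga ca]]] := clpi e e0.
  have N0 : 0 < mxN (invmx a).
    rewrite mxN_gt0; apply/eqP => h.
    have /eqP := mulmxV (dense_group_unit Ga).
    by rewrite h mulmx0 eq_sym -mxrank_eq0 mxrank1 eqn0Ngt d0.
  exists ((mxN (invmx a))^-1 *: invmx a); last first.
    by rewrite mxNZ normfV gtr0_norm// mulVf// gt_eqF.
  split; first by rewrite mxNZ normfV gtr0_norm// mulVf// gt_eqF.
  by exists a, c, (mxN (invmx a))^-1; split=> //; rewrite mxN_distC.
have L0 : L != 0.
  apply/eqP => L0; have [B [NB _]] := clL 1 ltr01.
  by rewrite L0 subr0 NB ltxx.
(* The rank of [L] is unknown, but multiplying on the left by the rank one [pi] gives limits with
   the same column [p]; a generic [g] keeps both rows nonzero. *)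
have [g Gg [phi_gL phi_gVL]] := dense_groupP dG
  (generic_and (generic_mul phi00 L0) (generic_mulV phi00 L0)).
exists p, (phi0 *m g *m L), (phi0 *m invmx g *m L); split=> // e e0.
pose M := (mxN g + mxN (invmx g) + 1) * (1 + mxN pi).
have M0 : 0 < M.
  by apply: mulr_gt0; [apply: ltr_wpDl; rewrite ?addr_ge0|exact: ltr_wpDr].
have [B [NB [a [c [c' [Ga ca Ba]]]]] BL] := clL _ (divr_gt0 e0 M0).
have approx h : mxN h <= mxN g + mxN (invmx g) ->
    mxN ((c * c') *: (a *m h *m invmx a) - p *m (phi0 *m h *m L)) < e.
  move=> hg; rewrite !mulmxA -piE.
  have -> : (c * c') *: (a *m h *m invmx a) - pi *m h *m L =
      (c *: a - pi) *m h *m B + pi *m h *m (B - L).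
    rewrite mulmxBr !mulmxBl addrA subrK Ba; congr (_ - _).
    by rewrite -!scalemxAl -scalemxAr scalerA.
  apply: le_lt_trans (mxND _ _) _.
  have h1 : mxN ((c *: a - pi) *m h *m B) <= mxN (c *: a - pi) * mxN h.
    by apply: le_trans (mxNM _ _) _; rewrite NB mulr1 mxNM.
  have h2 : mxN (pi *m h *m (B - L)) <= mxN pi * mxN h * mxN (B - L).
    by apply: le_trans (mxNM _ _) _; rewrite ler_wpM2r// mxNM.
  pose e1 := e / M; have e10 : 0 < e1 by rewrite divr_gt0.
  have eM : e = e1 * M by rewrite /e1 mulfVK// gt_eqF.
  have h3 : mxN (c *: a - pi) * mxN h <= e1 * mxN h by rewrite ler_wpM2r// ltW.
  have h4 : mxN pi * mxN h * mxN (B - L) <= mxN pi * mxN h * e1.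
    by rewrite ler_wpM2l ?mulr_ge0// ltW.
  have h5 : (1 + mxN pi) * mxN h < M.
    have pi1 : 0 < 1 + mxN pi by exact: ltr_wpDr.
    by rewrite /M mulrC ltr_pM2r//; apply: le_lt_trans hg _; rewrite ltrDl.
  have h6 : (1 + mxN pi) * mxN h * e1 < e by rewrite eM mulrC ltr_pM2l.
  lra.
have ug := dense_group_unit Gg; have ua := dense_group_unit Ga.
exists (a *m g *m invmx a).
  by do 2?[apply: (dense_groupM dG)] => //; exact: dense_groupV.
exists (c * c'), (c * c'); split; first by apply: approx; rewrite lerDl.
have -> : invmx (a *m g *m invmx a) = a *m invmx g *m invmx a.
  by apply: mulmx1_invmx; rewrite -!mulmxA (mulKmx ua) (mulKVmx ug) mulmxV.
by apply: approx; rewrite lerDr.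
Qed.

(** The rescaled [s^-1] times the rescaled [s] is the scalar [c * c']. As [d > 1], some nonzero [v]
    is killed by [phi], hence nearly killed by the rescaled [s]; so [c * c'] tends to 0 and the
    limit [p psi p phi] vanishes. *)
Lemma rank1_approx_mul0 (p : 'cV[R]_d) (phi psi : 'rV[R]_d) :
  (1 < d)%N -> p != 0 -> phi != 0 ->
  (forall e, 0 < e -> exists2 s, G s & rank1_approx p phi psi e s) ->
  psi *m p = 0.
Proof.
move=> d1 p0 phi0 apx.
have [v v0 phiv] : exists2 v : 'cV[R]_d, v != 0 & phi *m v = 0.
  by apply: exists_coker; exact: leq_ltn_trans (rank_leq_row _) d1.
pose A0 := p *m phi; pose B0 := p *m psi.
have X0 : B0 *m A0 = 0.
  apply/eqP; rewrite -mxN_eq0 eq_le mxN_ge0 andbT.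
  apply: (@ger_eps _ _ ((mxN B0 + 1) * mxN (1%:M : 'M[R]_d)
    + mxN B0 + mxN A0 + 1)) => e e0 e1.
  have [s Gs [c [c' [cs c's]]]] := apx e e0.
  set A := c *: s in cs; set B := c' *: invmx s in c's.
  have BA : B *m A = (c * c')%:M.
    rewrite -scalemxAl -scalemxAr scalerA mulVmx ?dense_group_unit//.
    by rewrite mulrC scalemx1.
  have NB : mxN B <= mxN B0 + 1.
    by apply: le_trans (mxN_triang _ B0) _; rewrite lerD2l; lra.
  have NA : mxN A <= mxN A0 + 1.
    by apply: le_trans (mxN_triang _ A0) _; rewrite lerD2l; lra.
  have cc : `|c * c'| <= (mxN B0 + 1) * e.
    have v_gt0 : 0 < mxN v by rewrite mxN_gt0.
    rewrite -(ler_pM2r v_gt0) -mxNZ -mul_scalar_mx -BA -mulmxA.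
    have -> : A *m v = (A - A0) *m v by rewrite mulmxBl -mulmxA phiv mulmx0 subr0.
    apply: le_trans (mxNM _ _) _; rewrite -mulrA ler_pM//.
    by apply: le_trans (mxNM _ _) _; rewrite ler_wpM2r// ltW.
  have -> : B0 *m A0 = B0 *m (A0 - A) + (B0 - B) *m A + (c * c') *: 1%:M.
    by rewrite scalemx1 -BA mulmxBr mulmxBl addrA subrK subrK.
  have h1 := mxND (B0 *m (A0 - A) + (B0 - B) *m A) ((c * c') *: 1%:M).
  have h2 := mxND (B0 *m (A0 - A)) ((B0 - B) *m A).
  have h3 : mxN (B0 *m (A0 - A)) <= mxN B0 * e.
    by apply: le_trans (mxNM _ _) _; rewrite ler_wpM2l// mxN_distC ltW.
  have h4 : mxN ((B0 - B) *m A) <= e * (mxN A0 + 1).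
    by apply: le_trans (mxNM _ _) _; rewrite ler_pM// mxN_distC ltW.
  have h5 : mxN ((c * c') *: (1%:M : 'M[R]_d)) <=
      (mxN B0 + 1) * e * mxN (1%:M : 'M[R]_d) by rewrite mxNZ ler_wpM2r.
  lra.
have : p *m (psi *m p) *m phi = 0 by rewrite -mulmxA -X0 /A0 /B0 !mulmxA.
rewrite (mx11_scalar (psi *m p)) mul_mx_scalar -scalemxAl => /eqP.
rewrite scaler_eq0 => /orP[/eqP ->|]; first by apply/matrixP => i j; rewrite !mxE mul0rn.
case/rV0Pn: phi0 => j phij; case/cV0Pn: p0 => i pi0 /eqP/matrixP/(_ i j).
by rewrite !mxE big_ord1 => /eqP; rewrite mulf_eq0 (negPf phij) (negPf pi0).
Qed.

End RankOnePair.

(** * Dynamics near a rank one matrix *)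

Lemma scalemxE (R : pzRingType) m n (a : R) (A : 'M[R]_(m, n)) i j :
  (a *: A) i j = a * A i j.
Proof. by rewrite mxE. Qed.

Section Projective.
Variables (R : realType) (d : nat).
Implicit Types (p w x y v : 'cV[R]_d) (u phi th : 'rV[R]_d).

(** A projective neighbourhood of the point [w]. The error is relative, for invariance under scaling
    of [y]; the vector [y = 0] always belongs to it, hence the condition [y != 0] in
    [nonprop_sep]. *)
Definition near_line (eta : R) w y := exists l, mxN (y - l *: w) <= eta * mxN y.

Lemma near_lineZ eta w y c : near_line eta w y -> near_line eta w (c *: y).
Proof.
move=> [l hl]; exists (c * l).
by rewrite -scalerA -scalerBr !mxNZ mulrCA ler_wpM2l.
Qed.

Lemma near_line_le eta eta' w y :
  eta <= eta' -> near_line eta w y -> near_line eta' w y.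
Proof.
by move=> le [l hl]; exists l; apply: le_trans hl _; rewrite ler_wpM2r.
Qed.

Lemma mxN_mul11 u y : `|(u *m y) 0 0| <= mxN u * mxN y.
Proof. by rewrite -mxN_scalar mxNM. Qed.

Lemma approx_near p phi (g h : 'M[R]_d) (dl eta : R) : 0 < dl -> 0 < eta ->
  g *m p != 0 -> exists2 e, 0 < e & forall c s, mxN (c *: s - p *m phi) < e ->
    forall x, dl * mxN x < `|(phi *m h *m x) 0 0| ->
      near_line eta (g *m p) (g *m s *m h *m x).
Proof.
move=> dl0 eta0 gp0; pose W := mxN (g *m p).
have W0 : 0 < W by rewrite mxN_gt0.
pose K := mxN g * mxN h; have K0 : 0 <= K by rewrite mulr_ge0.
have D0 : 0 < (K + 1) * (1 + eta) by apply: mulr_gt0; lra.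
(* The goal is [mxN E <= eta * mxN (c *: y)], while [mxN (c *: y)] is only known to be at least
   [|mu| * W - mxN E]; this costs the factor [1 + eta]. *)
pose e := eta * W * dl / ((K + 1) * (1 + eta)).
have e0 : 0 < e by rewrite divr_gt0// !mulr_gt0.
have eE : e * ((K + 1) * (1 + eta)) = eta * W * dl by rewrite mulfVK// gt_eqF.
exists e => // c s cs x; set mu := (phi *m h *m x) 0 0 => xmu.
set y := g *m s *m h *m x; pose E := c *: y - mu *: (g *m p).
have EE : E = g *m (c *: s - p *m phi) *m h *m x.
  rewrite mulmxBr !mulmxBl /E /y; congr (_ - _); first by rewrite -!scalemxAr -!scalemxAl.
  rewrite -mul_mx_scalar -mx11_scalar !mulmxA.
  by rewrite -!mulmxA.
have NE : mxN E <= K * e * mxN x.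
  rewrite EE; apply: le_trans (mxNM _ _) _; rewrite ler_wpM2r//.
  apply: le_trans (mxNM _ _) _; rewrite /K mulrAC ler_wpM2r//.
  by apply: le_trans (mxNM _ _) _; rewrite ler_wpM2l// ltW.
have mu0 : 0 < `|mu| by apply: le_lt_trans xmu; rewrite mulr_ge0// ltW.
have NE2 : mxN E * (1 + eta) <= eta * W * `|mu|.
  apply: (@le_trans _ _ (e * ((K + 1) * (1 + eta)) * mxN x)); last first.
    rewrite eE -mulrA ler_wpM2l ?ltW// mulr_gt0//.
  have eta1 : 0 <= 1 + eta by lra.
  have : 0 <= mxN x * e * (1 + eta).
    by apply: mulr_ge0 => //; apply: mulr_ge0 => //; exact: ltW.
  have : mxN E * (1 + eta) <= K * e * mxN x * (1 + eta).
    by rewrite ler_wpM2r//; lra.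
  lra.
have Ncy : `|mu| * W <= mxN (c *: y) + mxN E.
  rewrite -mxNZ; apply: le_trans (mxN_triang _ (c *: y)) _.
  by rewrite lerD2l mxN_distC.
have c0 : c != 0.
  apply/eqP => c0; move: Ncy; rewrite c0 scale0r mxN0 add0r => Ncy.
  have : 0 < `|mu| * W by rewrite mulr_gt0.
  nra.
exists (mu / c).
have -> : y - (mu / c) *: (g *m p) = c^-1 *: E.
  by rewrite /E scalerBr !scalerA mulVf// scale1r mulrC.
rewrite mxNZ normfV mulrC ler_pdivrMr ?normr_gt0//.
rewrite -mulrA [mxN y * _]mulrC -mxNZ; nra.
Qed.

(** Not symmetric: [w] may be zero, [w'] may not. *)
Definition nonprop w w' := exists2 u : 'rV[R]_d, u *m w = 0 & u *m w' != 0.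

(** The functional [u] is small on vectors near the line of [w] and comparable to [mxN y] near that
    of [w']. *)
Lemma nonprop_sep w w' : nonprop w w' -> exists2 eta, 0 < eta &
  forall y, y != 0 -> near_line eta w y -> near_line eta w' y -> False.
Proof.
move=> [u uw uw'].
pose kap := `|(u *m w') 0 0|.
have kap0 : 0 < kap by rewrite /kap -mxN_scalar mxN_gt0.
pose B := kap + 2 * mxN w' * mxN u.
have B0 : 0 < B by rewrite ltr_wpDr// !mulr_ge0.
pose eta := kap / (2 * B).
have eta0 : 0 < eta by rewrite divr_gt0// mulr_gt0.
have etaB : eta * B = kap / 2.
  by rewrite /eta invfM mulrA mulfVK// gt_eqF.
exists eta => // y y0 [l hl] [l' hl'].
have Ny : 0 < mxN y by rewrite mxN_gt0.
have h1 : `|(u *m y) 0 0| <= mxN u * (eta * mxN y).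
  have -> : u *m y = u *m (y - l *: w).
    by rewrite mulmxBr -scalemxAr uw scaler0 subr0.
  by apply: le_trans (mxN_mul11 _ _) _; rewrite ler_wpM2l.
have h2 : mxN y <= `|l'| * mxN w' + eta * mxN y.
  by rewrite -mxNZ; apply: le_trans (mxN_triang _ (l' *: w')) _; rewrite lerD2l.
have h3 : `|l'| * kap <= 2 * mxN u * eta * mxN y.
  have E : (u *m (y - l' *: w')) 0 0 = (u *m y) 0 0 - l' * (u *m w') 0 0.
    by rewrite mulmxBr -scalemxAr; move: (u *m y) (u *m w') => a b; rewrite !mxE.
  have -> : `|l'| * kap = `|(u *m y) 0 0 - (u *m (y - l' *: w')) 0 0|.
    by rewrite E opprB addrC subrK normrM.
  apply: le_trans (ler_normB _ _) _.
  have : `|(u *m (y - l' *: w')) 0 0| <= mxN u * (eta * mxN y).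
    by apply: le_trans (mxN_mul11 _ _) _; rewrite ler_wpM2l.
  lra.
have h4 : mxN y * kap <= `|l'| * kap * mxN w' + eta * mxN y * kap.
  have := ler_wpM2r (ltW kap0) h2; lra.
have h5 : `|l'| * kap * mxN w' <= 2 * mxN u * eta * mxN y * mxN w'.
  by rewrite ler_wpM2r.
have : mxN y * kap <= mxN y * (eta * B) by rewrite /B; lra.
rewrite etaB ler_pM2l//; lra.
Qed.

Lemma near_line_small th w y eta (dl : R) : th *m w = 0 -> near_line eta w y ->
  mxN th * eta <= dl -> `|(th *m y) 0 0| <= dl * mxN y.
Proof.
move=> thw [l hl] hdl.
have -> : th *m y = th *m (y - l *: w).
  by rewrite mulmxBr -scalemxAr thw scaler0 subr0.
apply: le_trans (mxN_mul11 _ _) _; apply: le_trans (_ : mxN th * (eta * mxN y) <= _).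
  by rewrite ler_wpM2l.
by rewrite mulrA ler_wpM2r.
Qed.

Lemma minor_nonprop w w' i j :
  w i 0 * w' j 0 - w j 0 * w' i 0 != 0 -> nonprop w w'.
Proof.
move=> m0; exists (w i 0 *: delta_mx 0 j - w j 0 *: delta_mx 0 i).
  apply/matrixP => a b; rewrite !ord1 mulmxBl -!scalemxAl -!rowE !mxE.
  by rewrite mulrC subrr.
apply: contraNneq m0 => /matrixP/(_ 0 0).
by rewrite mulmxBl -!scalemxAl -!rowE !mxE => ->.
Qed.

(** If all these minors vanish, every vector is an eigenvector: basis vectors make [c] diagonal, and
    sums of two of them make the diagonal constant. *)
Lemma nonscalar_minor (c : 'M[R]_d) : ~~ is_scalar_mx c ->
  exists v i j, v i 0 * (c *m v) j 0 - v j 0 * (c *m v) i 0 != 0.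
Proof.
move=> nc; apply: contrapT => none.
have {none} c_eq v i j : v i 0 * (c *m v) j 0 = v j 0 * (c *m v) i 0.
  apply/eqP; rewrite -subr_eq0; apply/negPn/negP => h; apply: none.
  by exists v, i, j.
have off a b : a != b -> c a b = 0.
  move=> ab; have := c_eq (delta_mx b 0) b a.
  by rewrite -!colE !mxE !eqxx (negPf ab) mul1r mul0r.
case/negP: nc; apply/is_scalar_mxP.
have [d0|d0] := posnP d.
  exists 0; apply/matrixP => i.
  by have d1 := leq_ltn_trans (leq0n i) (ltn_ord i); rewrite d0 in d1.
exists (c (Ordinal d0) (Ordinal d0)); apply/matrixP => i j; rewrite !mxE.
have [<-{j}|/off->//] := eqVneq i j.
have [->|i0] := eqVneq i (Ordinal d0); first by rewrite mulr1n.
have oi : Ordinal d0 == i = false by rewrite eq_sym (negPf i0).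
have := c_eq (delta_mx i 0 + delta_mx (Ordinal d0) 0) (Ordinal d0) i.
rewrite mulmxDr -!colE !mxE oi (negPf i0) !eqxx /= (off i _ i0) (off (Ordinal d0) i) ?oi//.
by rewrite !(addr0, add0r, mul1r) mulr1n.
Qed.

(** The nonscalar [a^-1 b] moves some vector [v] off its line. The polynomial is the corresponding
    minor, and it does not vanish at a matrix taking [p] to [v]. *)
Lemma generic_moved (a b : 'M[R]_d) p : a \in unitmx ->
  ~~ is_scalar_mx (invmx a *m b) -> p != 0 ->
  generic (fun A => nonprop (a *m A *m p) (b *m A *m p)).
Proof.
move=> ua /nonscalar_minor[v [i [j minor]]] /cV0Pn[k pk].
set c := invmx a *m b in minor.
exists (fun A => (1%:M *m A *m p) i 0 * (c *m A *m p) j 0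
  - (1%:M *m A *m p) j 0 * (c *m A *m p) i 0), 2%N; split.
- by apply: polyfD; [|apply: polyfN]; apply: polyfM; exact: polyf_mx_lin.
- move=> e A; rewrite -!scalemxAr -!scalemxAl.
  by rewrite !scalemxE; ring.
- exists ((p k 0)^-1 *: (v *m delta_mx 0 k)).
  have E : (p k 0)^-1 *: (v *m delta_mx 0 k) *m p = v.
    rewrite -scalemxAl -mulmxA -rowE.
    have -> : row k p = (p k 0)%:M by apply/matrixP => x y; rewrite !ord1 !mxE eqxx mulr1n.
    by rewrite mul_mx_scalar scalerA mulVf// scale1r.
  by rewrite mul1mx -(mulmxA c) E.
- move=> A _; rewrite mul1mx => /minor_nonprop[u uA ucA].
  exists (u *m invmx a); first by rewrite -!mulmxA mulKmx// mulmxA.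
  by move: ucA; rewrite /c !mulmxA.
Qed.

Lemma generic_escape w (b : 'M[R]_d) p : (1 < d)%N -> b \in unitmx -> p != 0 ->
  generic (fun A => nonprop w (b *m A *m p)).
Proof.
move=> d1 ub p0.
have [v v0 wv] : exists2 v : 'cV[R]_d, v != 0 & w^T *m v = 0.
  by apply: exists_coker; exact: leq_ltn_trans (rank_leq_row _) d1.
have vw : v^T *m w = 0 by apply: trmx_inj; rewrite trmx_mul trmxK wv trmx0.
have vb0 : v^T *m b != 0.
  apply: contraNneq v0 => vb.
  by rewrite -(trmxK v) -(mulmxK ub v^T) vb mul0mx trmx0.
apply: (generic_sub _ (generic_mul vb0 p0)) => A _ h.
by exists v^T => //; rewrite !mulmxA.
Qed.

End Projective.

(** * General position *)

Lemma rank_adds_row (F : fieldType) m n (u : 'rV[F]_n) (B : 'M[F]_(m, n)) :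
  ~~ (u <= B)%MS -> \rank (<<u>> + B)%MS = (\rank B).+1.
Proof.
move=> uB; apply/eqP; rewrite eqn_leq; apply/andP; split.
  apply: leq_trans (mxrank_adds_leqif _ _) _.
  by rewrite -[leqRHS]add1n leq_add2r mxrank_gen rank_leq_row.
apply: rank_ltmx; rewrite ltmxE addsmxSr; apply: contra uB => h.
by apply: submx_trans h; rewrite -(genmxE u); exact: addsmxSl.
Qed.

Section GeneralPosition.
Variables (R : realType) (d M : nat).
Implicit Types (th : 'I_M -> 'rV[R]_d) (J : {set 'I_M}).

Definition gpos th J := \rank (\sum_(i in J) <<th i>>)%MS = #|J|.

(** Any [d] of the functionals form a basis of the dual space, so [x] is recovered from its [d]
    values with coefficients of total norm [K]. Values of size at most [mxN x / (K + 1)] then force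
    [x = 0], and one [dl] serves the finitely many [J]. *)
Lemma gpos_multiplicity th : (forall J, (#|J| <= d)%N -> gpos th J) ->
  exists2 dl : R, 0 < dl & forall x : 'cV[R]_d, x != 0 ->
    (#|[set i | (`|(th i *m x) 0 0| <= dl * mxN x)%R]%SET| < d)%N.
Proof.
move=> gp.
have [|J|dl dl0 dlP] := @common_eps R _ (fun (J : {set 'I_M}) (dl : R) => #|J| = d ->
    forall x : 'cV[R]_d, (forall i, i \in J -> `|(th i *m x) 0 0| <= dl * mxN x) ->
    x = 0).
- move=> J e e' e'0 le h Jd x hx; apply: h => // i iJ.
  by apply: le_trans (hx i iJ) _; rewrite ler_wpM2r.
- have [Jd|/eqP nJd] := eqVneq #|J| d; last by exists 1.
  have full : (1%:M <= \sum_(i in J) <<th i>>)%MS.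
    have := gp J; rewrite /gpos Jd => /(_ (leqnn d)) rJ.
    by rewrite sub1mx -col_leq_rank rJ.
  have [u_ uE] := sub_sumsmxP full.
  have /choice[D DE] : forall i, exists D, <<th i>>%MS = D *m th i.
    by move=> i; apply/submxP; rewrite genmxE.
  pose K := \sum_(i in J) mxN (u_ i *m D i).
  have K0 : 0 <= K by exact: sumr_ge0.
  have K1 : 0 < K + 1 by lra.
  exists (K + 1)^-1 => [|_ x hx]; first by rewrite invr_gt0.
  apply/eqP; rewrite -mxN_eq0; apply/eqP/le_anti; rewrite mxN_ge0 andbT.
  have : mxN x <= K * ((K + 1)^-1 * mxN x).
    have {1}-> : x = \sum_(i in J) (u_ i *m D i) *m (th i *m x).
      rewrite -{1}(mul1mx x) uE mulmx_suml; apply: eq_bigr => i _.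
      by rewrite DE !mulmxA.
    apply: (@le_trans _ _ (\sum_(i in J) mxN ((u_ i *m D i) *m (th i *m x)))).
      elim/big_ind2: _ => [|A a B b hA hB|//]; first by rewrite mxN0.
      by apply: le_trans (mxND _ _) _; exact: lerD.
    rewrite /K mulr_suml; apply: ler_sum => i iJ.
    apply: le_trans (mxNM _ _) _; rewrite ler_wpM2l// mxN_scalar.
    exact: hx.
  rewrite mulrA -subr_ge0 -{2}(mul1r (mxN x)) -mulrBl.
  have -> : K * (K + 1)^-1 - 1 = - (K + 1)^-1 by field; rewrite gt_eqF.
  by rewrite mulNr oppr_ge0 pmulr_rle0// invr_gt0.
exists dl => // x x0; rewrite ltnNge; apply/negP => /card_geqP[s [us ss sP]].
move/eqP: x0; apply; apply: (dlP [set i in s]%SET).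
  by rewrite cardsE (card_uniqP us).
by move=> i; rewrite inE => /sP; rewrite inE.
Qed.

Lemma gpos_extend th J i0 : i0 \in J -> gpos th (J :\ i0) ->
  ~~ (th i0 <= \sum_(i in J :\ i0) <<th i>>)%MS -> gpos th J.
Proof.
move=> i0J gpJ nth; rewrite /gpos (big_setD1 i0)//= rank_adds_row// gpJ.
by rewrite [RHS](cardsD1 i0) i0J.
Qed.

End GeneralPosition.

Section GenericFamily.
Variables (R : realType) (d M : nat) (G : set 'M[R]_d).
Hypotheses (dG : dense_group G) (d1 : (1 < d)%N).
Variables (p : 'cV[R]_d) (vth : 'I_M -> 'rV[R]_d) (Fs : seq 'M[R]_d).
Hypotheses (p0 : p != 0) (vth0 : forall i, vth i != 0).
Hypothesis Fs_unit : forall a, a \in Fs -> a \in unitmx.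
Hypothesis Fs_proj : forall a b, a \in Fs -> b \in Fs -> a != b ->
  ~~ is_scalar_mx (invmx a *m b).

(** Elements are chosen one at a time. The order [i <= j] suits the asymmetric [nonprop]:
    [generic_escape] puts the new element on the right, and [i = j] covers two members of [Fs]
    acting on one element. *)
Definition generic_upto m (k : 'I_M -> 'M[R]_d) :=
  [/\ forall i, G (k i),
      forall (i j : 'I_M) a b, (i <= j < m)%N -> a \in Fs -> b \in Fs ->
        (a, i) != (b, j) -> nonprop (a *m k i *m p) (b *m k j *m p) &
      forall J : {set 'I_M}, (forall i : 'I_M, i \in J -> (i < m)%N) -> (#|J| <= d)%N ->
        gpos (fun i => vth i *m invmx (k i)) J].

Lemma generic_upto_ex m : exists k, generic_upto m k.
Proof.
elim: m => [|m [k [kG ksep kgp]]].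
  exists (fun=> 1%:M); split=> [_|i j a b|J J0 _].
  - exact: dense_group1 dG.
  - by rewrite ltn0 andbF.
  - have -> : J = finset.set0 by apply/setP => i; rewrite inE; apply/negP => /J0.
    by rewrite /gpos big_set0 mxrank0 cards0.
have [mM|Mm] := ltnP m M; last first.
  have lt_m (i : 'I_M) : (i < m)%N by exact: leq_trans (ltn_ord i) Mm.
  exists k; split=> // [i j a b /andP[ij _]|J _].
    by apply: ksep; rewrite ij lt_m.
  by apply: kgp => i _.
pose i0 := Ordinal mM.
pose th i := vth i *m invmx (k i).
have gen1 : generic (fun A => forall a, a \in Fs -> forall b, b \in Fs ->
    a != b -> nonprop (a *m A *m p) (b *m A *m p)).
  apply: generic_all => a aF; apply: generic_all => b bF.
  have [->|ab] := eqVneq a b; first exact: generic_true.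
  apply: (generic_sub _ (generic_moved (b := b) (Fs_unit aF) _ p0)) => //.
  exact: Fs_proj.
have gen2 : generic (fun A => forall i : 'I_M, forall a, a \in Fs -> forall b, b \in Fs ->
    nonprop (a *m k i *m p) (b *m A *m p)).
  apply: generic_forall => i; apply: generic_all => a aF.
  by apply: generic_all => b bF; exact: generic_escape (Fs_unit bF) p0.
(* Fewer than [d] functionals have a common nonzero kernel vector [v]; it suffices that the new one
   does not kill [v]. *)
have gen3 : generic (fun A => forall J : {set 'I_M},
    (forall i : 'I_M, i \in J -> (i < m)%N) -> (#|J| < d)%N ->
    ~~ (vth i0 *m invmx A <= \sum_(i in J) <<th i>>)%MS).
  apply: generic_forall => J.
  have [Jm|nJm] := pselect (forall i : 'I_M, i \in J -> (i < m)%N); last exact: generic_true.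
  have [Jd|nJd] := boolP (#|J| < d)%N; last exact: generic_true.
  have [v v0 Jv] : exists2 v : 'cV[R]_d, v != 0 & (\sum_(i in J) <<th i>>)%MS *m v = 0.
    by apply: exists_coker; rewrite (kgp _ Jm (ltnW Jd)).
  apply: (generic_sub _ (generic_mulV (vth0 i0) v0)) => A _ h _ _.
  by apply: contra h => /submxP[D ->]; rewrite -mulmxA Jv mulmx0.
have [g Gg [g1 [g2 g3]]] := dense_groupP dG (generic_and gen1 (generic_and gen2 gen3)).
pose k' i := if i == i0 then g else k i.
have k'i0 : k' i0 = g by rewrite /k' eqxx.
have k'E (i : 'I_M) : (i < m)%N -> k' i = k i.
  by move=> im; rewrite /k'; case: eqP im => [->|]; rewrite ?ltnn.
have lt_m (i : 'I_M) : (i <= m)%N -> i != i0 -> (i < m)%N.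
  by rewrite leq_eqVlt => /orP[/eqP im /eqP[]|//]; exact: val_inj.
exists k'; split=> [i|i j a b|J Jm Jd].
- by rewrite /k'; case: eqP.
- rewrite ltnS => /andP[ij jm] aF bF abij.
  have [ji0|ji0] := eqVneq j i0.
    rewrite ji0 k'i0; have [ii0|ii0] := eqVneq i i0.
      rewrite ii0 k'i0; apply: g1 => //.
      by apply: contraNneq abij => ->; rewrite ii0 ji0.
    by rewrite k'E ?lt_m ?(leq_trans ij jm)//; exact: g2.
  have {}jm := lt_m _ jm ji0.
  by rewrite !k'E ?(leq_ltn_trans ij)//; apply: ksep; rewrite ?ij.
- have J'm i : i \in J :\ i0 -> (i < m)%N.
    by rewrite !inE => /andP[ii0 /Jm]; rewrite ltnS => /lt_m; exact.
  have sumE J' : (forall i : 'I_M, i \in J' -> (i < m)%N) ->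
      (\sum_(i in J') <<vth i *m invmx (k' i)>> = \sum_(i in J') <<th i>>)%MS.
    by move=> J'lt; apply: eq_bigr => i /J'lt im; rewrite k'E.
  have [i0J|i0J] := boolP (i0 \in J); last first.
    have Jlt i : i \in J -> (i < m)%N.
      move=> iJ; apply: J'm; rewrite !inE iJ andbT.
      by apply: contraNneq i0J => <-.
    by rewrite /gpos sumE//; exact: kgp.
  have J'd : (#|J :\ i0| < d)%N by move: Jd; rewrite (cardsD1 i0) i0J.
  apply: gpos_extend i0J _ _.
    by rewrite /gpos sumE//; apply: kgp => //; exact: ltnW.
  by rewrite sumE// k'i0; exact: g3.
Qed.

Lemma generic_family : exists k : 'I_M -> 'M[R]_d,
  [/\ forall i, G (k i),
      forall (i j : 'I_M) a b, (i <= j)%N -> a \in Fs -> b \in Fs ->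
        (a, i) != (b, j) -> nonprop (a *m k i *m p) (b *m k j *m p) &
      forall J : {set 'I_M}, (#|J| <= d)%N ->
        gpos (fun i => vth i *m invmx (k i)) J].
Proof.
have [k [kG ksep kgp]] := generic_upto_ex M; exists k; split=> //.
  by move=> i j a b ij; apply: ksep; rewrite ij ltn_ord.
by move=> J; apply: kgp => i _.
Qed.

End GenericFamily.

(** * Lifting the group to matrices *)

Lemma toPSLV (R : fieldType) d (g : SL R d) : toPSL g^-1%g = (toPSL g)^-1%g.
Proof. exact/esym/PSL_invE. Qed.

Section Lift.
Variables (R : realType) (d : nat) (Gam : groupClosed (PSL R d)).
Hypothesis d0 : (0 < d)%N.
Implicit Types x y : subgroup Gam.

(** A set-theoretic section, in general not multiplicative; [lifts] therefore works up to a nonzero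
    scalar, which [near_lineZ] absorbs. *)
Definition lift x : 'M[R]_d := val (repr (val x)).

Definition lifts x (A : 'M[R]_d) := exists2 c, c != 0 & lift x = c *: A.

Lemma lift_unit x : lift x \in unitmx.
Proof. by rewrite unitmxE (eqP (valP (repr (val x)))) unitr1. Qed.

Lemma lift_inj : injective lift.
Proof.
move=> x y /val_inj xy; apply: val_inj.
by rewrite -(toPSL_repr (val x)) xy toPSL_repr.
Qed.

Lemma lifts_lift x : lifts x (lift x).
Proof. by exists 1; rewrite ?oner_neq0 ?scale1r. Qed.

Lemma toPSL_lifts (g : SL R d) x : toPSL g = val x -> lifts x (val g).
Proof.
move=> gx; have [|a a0 xg] := @toPSL_scale R d g (repr (val x)) d0.
  by rewrite toPSL_repr.
by exists a.
Qed.

Lemma lifts_mul x y A B : lifts x A -> lifts y B -> lifts (x * y)%g (A *m B).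
Proof.
move=> [a a0 xA] [b b0 yB].
have [|c c0 xyE] := @toPSL_lifts (repr (val x) * repr (val y))%g (x * y)%g.
  by rewrite toPSLM !toPSL_repr.
exists (c * (a * b)); first by rewrite !mulf_neq0.
by rewrite xyE SL_valM -/(lift x) -/(lift y) xA yB -scalemxAl -scalemxAr !scalerA mulrA.
Qed.

Lemma lifts_inv x A : lifts x A -> lifts x^-1%g (invmx A).
Proof.
move=> [a a0 xA].
have [|c c0 xE] := @toPSL_lifts (repr (val x))^-1%g x^-1%g.
  by rewrite toPSLV toPSL_repr.
have uA : A \in unitmx.
  by have := lift_unit x; rewrite xA !unitmxE detZ unitrM => /andP[].
exists (c * a^-1); first by rewrite mulf_neq0 ?invr_neq0.
rewrite xE SL_valV -/(lift x) xA -scalerA; congr (_ *: _).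
apply: mulmx1_invmx; rewrite -scalemxAl -scalemxAr scalerA mulfV// scale1r.
by rewrite mulmxV.
Qed.

Lemma lift_projective x y : x != y -> ~~ is_scalar_mx (invmx (lift x) *m lift y).
Proof.
apply: contra => xy; apply/eqP/val_inj.
rewrite -(toPSL_repr (val x)) -(toPSL_repr (val y)); apply/eqP.
by rewrite toPSL_eq SL_valM SL_valV.
Qed.

(** The full preimage in SL rather than the range of [lift], so as to be a group. *)
Definition lift_group : set 'M[R]_d :=
  [set A | exists2 g : SL R d, toPSL g \in Gam & val g = A].

Lemma lift_group_lifts A : lift_group A -> exists x, lifts x A.
Proof.
move=> [g gG <-]; exists (Sub (toPSL g) gG).
by apply: toPSL_lifts; rewrite SubK.
Qed.

Lemma lift_group_dense :
  zariski_dense [set x : PSL R d | x \in Gam] -> dense_group lift_group.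
Proof.
move=> dX; split.
- by exists 1%g => //; exact: gpred1.
- move=> A B [g gG <-] [h hG <-]; exists (g * h)%g => //.
  by rewrite toPSLM gpredM.
- by move=> A [g gG <-]; exists g^-1%g => //; rewrite toPSLV gpredV.
- by move=> A [g _ <-]; exact/eqP/(valP g).
- move=> P gP; have [g gG Pg] := zariski_dense_generic d0 dX gP.
  by exists (val g) => //; exists g.
Qed.

End Lift.

(** * The ping-pong sets in the group *)

Theorem proposition16 (R : realType) (d : nat) (hd : (2 <= d)%N)
    (Gam : groupClosed (PSL R d)) :
  zariski_dense [set x : PSL R d | x \in Gam]%classic ->
  PHP (subgroup Gam) R.
Proof.
move=> dX F finF eps eps0.
have d0 : (0 < d)%N by exact: ltnW.
have dG := lift_group_dense d0 dX.
have [p [phi [psi [p0 phi0 psi0 approx]]]] := rank1_pair dG d0.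
have psip := rank1_approx_mul0 dG hd p0 phi0 approx.
have /finite_seqP[s0 Fs0] := finF.
(* The identity is added to [F] because [nearC] at [a = 1] yields the inclusion of [C_j] in
   [D_j]. *)
pose s := (1%g : subgroup Gam) :: s0.
pose Fs := [seq lift x | x <- s].
have FsP x : F x -> x \in s by rewrite Fs0 inE => ->; rewrite orbT.
have lift_Fs x : x \in s -> lift x \in Fs by exact: map_f.
(* Ensures [2 * d <= eps * sqrt n] for [n >= N], where [2 * d] will bound the covering count. *)
pose N := (Num.trunc ((2 * d%:R / eps) ^+ 2)).+1.
exists N => n Nn.
(* One family of [2n] elements: [lshift n j] carries [g_j] with [psi], and [rshift n j] carries
   [h_j] with [phi]. *)
pose vth (e : 'I_(n + n)) := if fintype.split e then psi else phi.
have [|||k [kG ksep kgp]] := @generic_family R d (n + n) _ dG hd p vth Fs p0.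
- by move=> e; rewrite /vth; case: fintype.split.
- by move=> a /mapP[x _ ->]; exact: lift_unit.
- move=> a b /mapP[x _ ->] /mapP[y _ ->].
  by rewrite (inj_eq (@lift_inj _ _ _)); exact: lift_projective.
pose th e := vth e *m invmx (k e).
have [dl dl0 mult] := gpos_multiplicity kgp.
pose w (a : 'M[R]_d) (e : 'I_(n + n)) := a *m k e *m p.
have [|q|eta0 eta00 etasep] := @common_eps R
    ((seq_sub Fs * 'I_(n + n)) * (seq_sub Fs * 'I_(n + n)))%type (fun q eta =>
    nonprop (w (ssval q.1.1) q.1.2) (w (ssval q.2.1) q.2.2) -> forall y : 'cV[R]_d, y != 0 ->
    near_line eta (w (ssval q.1.1) q.1.2) y ->
    near_line eta (w (ssval q.2.1) q.2.2) y -> False).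
- move=> q e e' _ le h np y y0 n1 n2.
  by apply: (h np y y0); [exact: near_line_le n1|exact: near_line_le n2].
- have [np|np] := pselect (nonprop (w (ssval q.1.1) q.1.2) (w (ssval q.2.1) q.2.2)).
    by have [e e0 eP] := nonprop_sep np; exists e => // _.
  by exists 1.
have [|e|eta1 eta10 etasmall] :=
  @common_eps R 'I_(n + n) (fun e eta => mxN (th e) * eta <= dl).
- by move=> e e1 e2 _ le; apply: le_trans; rewrite ler_wpM2l.
- have Ne : 0 < mxN (th e) + 1 by rewrite ltr_wpDl.
  exists (dl / (mxN (th e) + 1)); first by rewrite divr_gt0.
  by rewrite mulrA ler_pdivrMr// mulrC ler_pM2l// lerDl.
(* [eta0] separates the points [a k_e p]; [eta1] keeps the neighbourhood of a point of hyperplane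
   [e] inside the [dl]-neighbourhood of that hyperplane. *)
pose eta := Num.min eta0 eta1.
have eta_gt0 : 0 < eta by rewrite lt_min eta00.
have ku e : k e \in unitmx by exact (dense_group_unit dG (kG e)).
have w0 a e : a \in unitmx -> w a e != 0.
  move=> ua; apply: contraNneq p0 => h.
  have <- : invmx (k e) *m (invmx a *m w a e) = p.
    by rewrite /w -!mulmxA (mulKmx ua) (mulKmx (ku e)).
  by rewrite h !mulmx0.
have Fs_unit (a : seq_sub Fs) : ssval a \in unitmx.
  by case: a => a /= /mapP[x _ ->]; exact: lift_unit.
have [|[a j]|e2 e20 near_w] := @common_eps R (seq_sub Fs * 'I_n)%type (fun q e =>
    let a := ssval q.1 in let l := lshift n q.2 in let r := rshift n q.2 in
    (forall c g, mxN (c *: g - p *m phi) < e -> forall x : 'cV[R]_d,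
      dl * mxN x < `|(phi *m invmx (k r) *m x) 0 0| ->
      near_line eta (w a l) (a *m k l *m g *m invmx (k r) *m x)) /\
    (forall c g, mxN (c *: g - p *m psi) < e -> forall x : 'cV[R]_d,
      dl * mxN x < `|(psi *m invmx (k l) *m x) 0 0| ->
      near_line eta (w a r) (a *m k r *m g *m invmx (k l) *m x))).
- move=> q e e' _ le [h1 h2]; split=> c g cg.
    by apply: h1; exact: lt_le_trans cg le.
  by apply: h2; exact: lt_le_trans cg le.
- have [e e0 h1] := @approx_near R d p phi (ssval a *m k (lshift n j))
    (invmx (k (rshift n j))) dl eta dl0 eta_gt0 (w0 _ _ (Fs_unit a)).
  have [e' e'0 h2] := @approx_near R d p psi (ssval a *m k (rshift n j))
    (invmx (k (lshift n j))) dl eta dl0 eta_gt0 (w0 _ _ (Fs_unit a)).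
  exists (Num.min e e'); first by rewrite lt_min e0.
  split=> c g; rewrite lt_min => /andP[g1 g2] x; [exact: h1 g1 x|exact: h2 g2 x].
have [g Gg [c [c' [cg c'g]]]] := approx e2 e20.
have ug : g \in unitmx by exact (dense_group_unit dG Gg).
pose T j := k (lshift n j) *m g *m invmx (k (rshift n j)).
have /choice[t tT] : forall j, exists x : subgroup Gam, lifts x (T j).
  move=> j; apply: lift_group_lifts => //.
  apply: (dense_groupM dG); first exact: (dense_groupM dG).
  exact: (dense_groupV dG).
have tTV j : lifts (t j)^-1%g (k (rshift n j) *m invmx g *m invmx (k (lshift n j))).
  have <- : invmx (T j) = k (rshift n j) *m invmx g *m invmx (k (lshift n j)).
    by apply: mulmx1_invmx; rewrite /T -!mulmxA mulKmx// mulKVmx// mulmxV.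
  exact: lifts_inv.
pose x0 : 'cV[R]_d := delta_mx (Ordinal d0) 0.
pose vec (x : subgroup Gam) := lift x *m x0.
have vec0 x : vec x != 0.
  have : x0 != 0 by apply/cV0Pn; exists (Ordinal d0); rewrite mxE !eqxx oner_neq0.
  by apply: contraNneq => h; rewrite -(mulKmx (lift_unit x) x0) -/(vec x) h mulmx0.
have near_vec x A v : lifts x A -> near_line eta v (A *m x0) -> near_line eta v (vec x).
  by move=> [b _ xA] /(near_lineZ b); rewrite scalemxAl -xA.
pose small e := [set x | `|(th e *m vec x) 0 0| <= dl * mxN (vec x)].
have thl j : th (lshift n j) = psi *m invmx (k (lshift n j)).
  by rewrite /th /vth (unsplitK (inl j)).
have thr j : th (rshift n j) = phi *m invmx (k (rshift n j)).
  by rewrite /th /vth (unsplitK (inr j)).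
pose D j := small (lshift n j); pose E j := small (rshift n j).
pose C j := ltrans (t j) (~` E j).
have nearC a j x : a \in s -> C j x -> near_line eta (w (lift a) (lshift n j)) (vec (a * x)%g).
  move=> /lift_Fs aF [y Ey <-].
  apply: near_vec (lifts_mul d0 (lifts_lift a) (lifts_mul d0 (tT j) (lifts_lift y))) _.
  rewrite /T !mulmxA -(mulmxA _ (lift y)) -/(vec y).
  apply: (near_w (SeqSub aF, j)).1 cg _ _.
  by rewrite ltNge -thr; exact/negP.
have nearD a j x : a \in s -> (~` D j) x ->
    near_line eta (w (lift a) (rshift n j)) (vec (a * (t j)^-1 * x)%g).
  move=> /lift_Fs aF Dx.
  apply: near_vec (lifts_mul d0 (lifts_mul d0 (lifts_lift a) (tTV j)) (lifts_lift x)) _.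
  rewrite !mulmxA -(mulmxA _ (lift x)) -/(vec x).
  apply: (near_w (SeqSub aF, j)).2 c'g _ _.
  by rewrite ltNge -thl; exact/negP.
exists t, C, D; split.
- move=> j x Cx; rewrite /D /small /=.
  apply: (@near_line_small _ _ _ (w (lift (1%g : subgroup Gam)) (lshift n j)) _ eta).
  + have l1 := @toPSL_lifts R d Gam d0 1%g 1%g erefl.
    case: l1 => b b0 ->.
    rewrite SL_val1 thl /w -!mulmxA -scalemxAl mul1mx -!scalemxAr mulKmx//.
    by rewrite psip scaler0.
  + by have := nearC 1%g j x (mem_head _ _) Cx; rewrite mul1g.
  + apply: le_trans (etasmall (lshift n j)); rewrite ler_wpM2l//.
    by rewrite ge_min lexx orbT.
(* Members of the family are told apart by their attracting points, [a g_i p] or [b h_j p]. Both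
   kinds are treated at once, with ordered indices because [nonprop] is not symmetric. *)
- pose pt (u : subgroup Gam * 'I_n + subgroup Gam * 'I_n) := match u with
    | inl q => (lift q.1, lshift n q.2) | inr q => (lift q.1, rshift n q.2) end.
  have pt_inj : injective pt.
    move=> [[a i]|[a i]] [[b j]|[b j]] h; have /= /lift_inj -> := congr1 fst h;
      have /= /eqP := congr1 snd h.
    + by rewrite (inj_eq (@lshift_inj _ _)) => /eqP ->.
    + by rewrite eq_lrshift.
    + by rewrite eq_rlshift.
    + by rewrite (inj_eq (@rshift_inj _ _)) => /eqP ->.
  have pt_Fs u : PHP_index F u -> (pt u).1 \in Fs.
    by case: u => [[a i]|[a i]] /= /FsP; exact: lift_Fs.
  have near_pt u x : PHP_index F u -> PHP_family t C D u x ->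
      near_line eta (w (pt u).1 (pt u).2) (vec x).
    case: u => [[a i]|[a i]] /= /FsP aF [y yC <-]; first exact: nearC.
    exact: nearD.
  have sep u v x : PHP_index F u -> PHP_index F v -> pt u != pt v ->
      ((pt u).2 <= (pt v).2)%N -> PHP_family t C D u x -> PHP_family t C D v x -> False.
    move=> Fu Fv uv le ux vx.
    apply: (etasep ((SeqSub (pt_Fs u Fu), (pt u).2),
      (SeqSub (pt_Fs v Fv), (pt v).2)) _ (vec x)) => //=.
    + by apply: ksep; [|exact: pt_Fs|exact: pt_Fs|rewrite -!surjective_pairing].
    + by apply: near_line_le (near_pt _ _ Fu ux); rewrite ge_min lexx.
    + by apply: near_line_le (near_pt _ _ Fv vx); rewrite ge_min lexx.
  move=> u v Fu Fv [x [ux vx]]; apply: pt_inj; apply/eqP/negPn/negP => uv.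
  have [le|lt] := leqP (pt u).2 (pt v).2; first exact: sep uv le ux vx.
  by apply: sep (ltnW lt) vx ux => //; rewrite eq_sym.
- apply: ge_sup; first by exists (#|PHP_cover t C D 1%g|%:R), 1%g.
  move=> _ [x _ <-].
  (* Through [lshift] and [rshift], the indices with [x] in [D_j] and those with [x] in [E_j] each
     embed into [S], which has fewer than [d] elements. *)
  have cov : (#|PHP_cover t C D x| <= 2 * d)%N.
    pose S := [set e | (`|(th e *m vec x) 0 0| <= dl * mxN (vec x))%R]%SET.
    have Sd : (#|S| < d)%N by exact: mult.
    apply: leq_trans (leq_card_setU _ _) _; rewrite mul2n -addnn; apply: leq_add.
      rewrite -(card_imset _ (@lshift_inj n n)); apply: leq_trans (ltnW Sd).
      apply/subset_leq_card/fintype.subsetP => e /imsetP[i iD ->].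
      by move: iD; rewrite !inE.
    rewrite -(card_imset _ (@rshift_inj n n)); apply: leq_trans (ltnW Sd).
    apply/subset_leq_card/fintype.subsetP => e /imsetP[i iE ->].
    move: iE; rewrite !inE; case=> y nCy yx.
    rewrite -[X in vec X]yx; apply: contrapT => nE; apply: nCy.
    by exists ((t i)^-1 * y)%g; [exact: nE|exact: mulVKg].
  apply: (@le_trans _ _ (2 * d%:R)); first by rewrite -natrM ler_nat.
  rewrite [leRHS]mulrC -ler_pdivrMr//.
  have q0 : 0 <= 2 * d%:R / eps by rewrite divr_ge0 ?mulr_ge0 ?ler0n ?ltW.
  rewrite -(ger0_norm q0) -sqrtr_sqr ler_sqrt ?ler0n//.
  by apply/ltW/(lt_le_trans (truncnS_gt _)); rewrite ler_nat.
Qed.
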